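(* Let $E=\{\zeta_j\}_{j=1}^n$ be a finite subset of the unit circle $\mathbb{T}$, let $F\subset\mathbb{T}$ be an arbitrary closed set, and assume $E\cap F=\emptyset$. Let $f$ be analytic on the unit disk $\mathbb{D}$ with $|f(0)|=1$, and suppose that for some constant $K>0$ and exponents $p,q,r\ge 0$, $$\log|f(z)|\le\frac{K}{(1-|z|)^p}\,\frac{\operatorname{dist}^r(z,E)}{\operatorname{dist}^q(z,F)}, \qquad z\in\mathbb{D}.$$ Then for every $\varepsilon>0$ there is a positive number $C_4=C_4(E,F,p,q,r,\varepsilon)$ such that $$\sum_{\zeta\in Z(f)} (1-|\zeta|)^{p+1+\varepsilon}\,\frac{\operatorname{dist}^{(q-\alpha(F)+\varepsilon)_+}(\zeta,F)}{\operatorname{dist}^{\min(p,r)}(\zeta,E)}\le C_4\cdot K.$$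
   Context: $Z(f)$ denotes the zero set of $f$ in $\mathbb{D}$, counted with multiplicities; $\operatorname{dist}$ is Euclidean distance; $a_+:=\max(a,0)$. The Ahern–Clark type of a closed set $F\subset\mathbb{T}$ is $$\alpha(F):=\sup\{\alpha\in\mathbb{R}: |\{t\in\mathbb{T}:\operatorname{dist}(t,F)<x\}|=O(x^\alpha),\ x\to+0\},$$ where $|\cdot|$ denotes Lebesgue (arc length) measure on $\mathbb{T}$. *)

(* Defs.v *)
From HB Require Import structures.
From mathcomp Require Import all_boot all_order all_algebra.
From mathcomp Require Import all_classical all_reals all_analysis.
From mathcomp Require Import complex.
Set Implicit Arguments. Unset Strict Implicit. Unset Printing Implicit Defensive.
Import Order.TTheory GRing.Theory Num.Theory numFieldNormedType.Exports.
Local Open Scope classical_set_scope.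
Local Open Scope ring_scope.
Local Open Scope complex_scope.

Section Defs.
Variable R : realType.

Definition cmod (z : R[i]) : R := ComplexField.Normc.normc z.

Definition pseries_to (c : nat -> R[i]) (z0 z w : R[i]) : Prop :=
  (fun N : nat => cmod (\sum_(k < N) c k * (z - z0) ^+ k - w)) @ \oo --> (0 : R).

Definition analytic_on_disk (f : R[i] -> R[i]) : Prop :=
  forall z0, cmod z0 < 1 ->
    exists2 rho : R, 0 < rho & exists c : nat -> R[i],
      forall z, cmod (z - z0) < rho -> cmod z < 1 -> pseries_to c z0 z (f z).

Definition zero_order (f : R[i] -> R[i]) (z0 : R[i]) (m : nat) : Prop :=
  exists2 rho : R, 0 < rho & exists c : nat -> R[i],
    [/\ (forall k, (k < m)%N -> c k = 0), c m != 0 &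
        forall z, cmod (z - z0) < rho -> cmod z < 1 -> pseries_to c z0 z (f z)].

(* Z(f) counted with multiplicities: a zero zeta of multiplicity m is
   represented by the m pairs (zeta, 0), ..., (zeta, m-1) *)
Definition zeros_mult (f : R[i] -> R[i]) : set (R[i] * nat) :=
  [set pk | cmod pk.1 < 1 /\ exists m, zero_order f pk.1 m /\ (pk.2 < m)%N].

Definition cdist (z : R[i]) (A : set R[i]) : R := inf [set cmod (z - w) | w in A].

Definition cclosed (A : set R[i]) : Prop :=
  forall z, (forall e : R, 0 < e -> exists2 w, A w & cmod (z - w) < e) -> A z.

Definition on_circle (z : R[i]) : Prop := cmod z = 1.

Definition nbhd_arc_measure (F : set R[i]) (x : R) : \bar R :=
  lebesgue_measure [set t : R | 0 <= t < 2 * pi /\ cdist (cos t +i* sin t) F < x].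

Definition bigO_at0 (F : set R[i]) (alpha : R) : Prop :=
  exists C : R, exists2 delta : R, 0 < delta &
    forall x : R, 0 < x -> x < delta -> (nbhd_arc_measure F x <= (C * x `^ alpha)%:E)%E.

Definition AC_type (F : set R[i]) : R := sup [set alpha : R | bigO_at0 F alpha].

End Defs.

(* Main.v *)
(** Zeros are sorted into dyadic classes by the sizes del of 1 - |zeta|, s of
    |zeta - e| (e the point of E nearest to zeta) and d of dist(zeta, F).  To
    count a class, consider the domain where 1 - |z| is at least a small multiple
    of del (max(|z - e|, s) / s)^gam and dist(z, F) at least a small multiple of
    d; here gam < 1 and gam p is min(p, r) up to eps / 6.  On it log|f| <= Phi
    for a harmonic Phi >= K del^(-p) s^(gam p) dist(z, F)^(-q), up to a constant, such
    that Phi(0) is governed by the covering numbers of F, hence by its Ahern-Clark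
    type.  On the
    boundary of the domain the Blaschke factor b of the disk at zeta is close to 1
    in modulus, and log|b| + Psi >= 0 for a harmonic Psi with
    Psi(0) <= del / 2.  The maximum principle for
    log|f| - sum (log|b| + Psi) - Phi, evaluated at 0 where log|f| = 0, bounds the
    number of zeros of the class by 2 Phi(0) / del.  The exponents gained from eps
    make the sum over the classes converge.

    Only explicit harmonic functions (real parts and log-moduli of rational
    functions) occur, so the maximum principle needs no integration: harmonicity is
    tested on the mean over four points. *)

Require Import Defs.
From HB Require Import structures.
From mathcomp Require Import all_boot all_order all_algebra.
From mathcomp Require Import all_classical all_reals all_analysis.
From mathcomp Require Import complex.
From mathcomp Require Import ring lra.
Import Order.TTheory GRing.Theory Num.Theory numFieldNormedType.Exports.
Local Open Scope classical_set_scope.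
Local Open Scope ring_scope.
Local Open Scope complex_scope.
Set Implicit Arguments. Unset Strict Implicit. Unset Printing Implicit Defensive.
Local Notation Re := (@complex.Re (Real.sort _)).
Local Notation Im := (@complex.Im (Real.sort _)).

(** The shape of the domain is dictated by E. Were its height constant, of order del, the factor
    dist(z, E)^r would be of order 1 on the boundary far from e, and no power of s could be gained.
    With a height growing like |z - e|^gam, the factor (1 - |z|)^p absorbs |z - e|^(gam p), and the
    quotient is at most a constant times del^(-p) s^(gam p) on the whole domain. The price is paid
    by the Blaschke factor: on the raised boundary far from e its deficit is of order del (1 - |z|)
    / |z - e|^2, that is del^2 s^(-gam) |z - e|^(gam - 2). A harmonic majorant of this has value of
    order del^2 / s at 0 as long as gam < 1, the range where x^(gam - 2) is integrable at infinity;
    hence the exponent p itself is only approached. The small multiples in the definition of the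
    domain are governed by one large constant M, which makes every correction at 0 a small multiple
    of del. *)

Section ComplexModulus.
Context {R : realType}.
Implicit Types (x y z w : R[i]) (a b t : R).

(** * Algebra and inequalities for the modulus *)

Lemma cmodE x : cmod x = Num.sqrt (Re x ^+ 2 + Im x ^+ 2).
Proof. by case: x. Qed.

Lemma cmod_ge0 x : 0 <= cmod x.
Proof. by rewrite cmodE sqrtr_ge0. Qed.

Lemma sqr_cmod x : cmod x ^+ 2 = Re x ^+ 2 + Im x ^+ 2.
Proof. by rewrite cmodE sqr_sqrtr // addr_ge0 // sqr_ge0. Qed.

Lemma cmodM x y : cmod (x * y) = cmod x * cmod y.
Proof. exact: ComplexField.Normc.normcM. Qed.

Lemma cmodV x : cmod x^-1 = (cmod x)^-1.
Proof. exact: ComplexField.Normc.normcV. Qed.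

Lemma cmod0 : cmod (0 : R[i]) = 0.
Proof. exact: ComplexField.Normc.normc0. Qed.

Lemma cmod1 : cmod (1 : R[i]) = 1.
Proof. exact: ComplexField.Normc.normc1. Qed.

Lemma cmod_eq0 x : (cmod x == 0) = (x == 0).
Proof.
apply/eqP/eqP => [|->]; last exact: cmod0.
exact: ComplexField.Normc.eq0_normc.
Qed.

Lemma cmod_gt0 x : (0 < cmod x) = (x != 0).
Proof. by rewrite lt_def cmod_ge0 andbT cmod_eq0. Qed.

Lemma cmodX x n : cmod (x ^+ n) = cmod x ^+ n.
Proof.
by elim: n => [|n IH]; rewrite ?expr0 ?cmod1 // !exprS cmodM IH.
Qed.

Lemma cmodN x : cmod (- x) = cmod x.
Proof. by case: x => a b; rewrite !cmodE /= !sqrrN. Qed.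

Lemma cmodB x y : cmod (x - y) = cmod (y - x).
Proof. by rewrite -cmodN opprB. Qed.

Lemma ler_cmodD x y : cmod (x + y) <= cmod x + cmod y.
Proof. by rewrite -lecR rmorphD; exact: (ComplexField.lec_normD x y). Qed.

Lemma ler_cmodB x y : cmod (x - y) <= cmod x + cmod y.
Proof. by rewrite -(cmodN y); exact: ler_cmodD. Qed.

Lemma ler_cmod_dist x y : `|cmod x - cmod y| <= cmod (x - y).
Proof.
have h (u v : R[i]) : cmod u <= cmod (u - v) + cmod v.
  by apply: le_trans (ler_cmodD _ _); rewrite subrK.
by rewrite ler_distlC; have := h x y; have := h y x; rewrite (cmodB y x); lra.
Qed.

Lemma cmod_triangle x y z : cmod (x - z) <= cmod (x - y) + cmod (y - z).
Proof. by apply: le_trans (ler_cmodD _ _); rewrite addrA subrK. Qed.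

Lemma cmod_sum (I : Type) (s : seq I) (P : pred I) (F : I -> R[i]) :
  cmod (\sum_(i <- s | P i) F i) <= \sum_(i <- s | P i) cmod (F i).
Proof.
elim/big_rec2: _ => [|i u v _ h]; first by rewrite cmod0.
by apply: le_trans (ler_cmodD _ _) _; rewrite lerD2l.
Qed.

Lemma cmodR a : cmod a%:C = `|a|.
Proof. by rewrite cmodE /= expr0n /= addr0 sqrtr_sqr. Qed.

Lemma cmodi : cmod ('i%C : R[i]) = 1.
Proof. by rewrite cmodE /= expr0n /= add0r expr1n sqrtr1. Qed.

Lemma cmod_conj x : cmod x^* = cmod x.
Proof. by case: x => a b; rewrite !cmodE /= sqrrN. Qed.

Lemma ler_Re_cmod x : `|Re x| <= cmod x.
Proof.
rewrite -(@ler_pXn2r _ 2%N) ?nnegrE ?normr_ge0 ?cmod_ge0 //.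
by rewrite real_normK ?num_real // sqr_cmod lerDl sqr_ge0.
Qed.

Lemma ler_Im_cmod x : `|Im x| <= cmod x.
Proof.
rewrite -(@ler_pXn2r _ 2%N) ?nnegrE ?normr_ge0 ?cmod_ge0 //.
by rewrite real_normK ?num_real // sqr_cmod lerDr sqr_ge0.
Qed.

Lemma ReD x y : Re (x + y) = Re x + Re y. Proof. by case: x; case: y. Qed.
Lemma ReB x y : Re (x - y) = Re x - Re y. Proof. by case: x; case: y. Qed.
Lemma ImB x y : Im (x - y) = Im x - Im y. Proof. by case: x; case: y. Qed.
Lemma ReZ a x : Re (a%:C * x) = a * Re x.
Proof. by case: x => u v /=; rewrite mul0r subr0. Qed.

Lemma Re_inv x : Re x^-1 = Re x / cmod x ^+ 2.
Proof. by rewrite sqr_cmod; case: x. Qed.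

End ComplexModulus.

(** * Harmonicity tested on four-point means *)

Section DiscreteLaplacian.
Context {R : realType}.
Implicit Types (x y z w : R[i]) (a b t : R).

(* Four times the excess of the mean of [h] over the points [z + t i^k], k < 4,
   over its value at [z]; it is O(t^3) when [h] is harmonic at [z]. *)
Definition dlap (h : R[i] -> R) z t : R :=
  h (z + t%:C) + h (z + 'i%C * t%:C) + h (z - t%:C) + h (z - 'i%C * t%:C) - 4 * h z.

(** An error of order t^3 is small enough: the maximum principle sets it against the 4 t^2
    contributed by |z|^2. *)
Definition dharm (h : R[i] -> R) z : Prop :=
  exists C : R, exists2 r : R, 0 < r &
    forall t : R, 0 < t -> t < r -> `|dlap h z t| <= C * t ^+ 3.

Definition taylor2 (phi : R[i] -> R[i]) z : Prop :=
  exists c1 c2 : R[i], exists C : R, exists2 r : R, 0 < r &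
    forall h, cmod h < r ->
      cmod (phi (z + h) - (phi z + c1 * h + c2 * h ^+ 2)) <= C * cmod h ^+ 3.

Lemma dharm_ext h1 h2 z : dharm h1 z -> h1 =1 h2 -> dharm h2 z.
Proof. by move=> + /funext <-. Qed.

Lemma dharmD h1 h2 z : dharm h1 z -> dharm h2 z -> dharm (fun x => h1 x + h2 x) z.
Proof.
move=> [C1 [r1 r10 H1]] [C2 [r2 r20 H2]].
exists (C1 + C2), (Num.min r1 r2); first by rewrite lt_min r10 r20.
move=> t t0; rewrite lt_min => /andP[t1 t2].
rewrite mulrDl; apply: le_trans (lerD (H1 t t0 t1) (H2 t t0 t2)).
apply: le_trans (ler_normD _ _); rewrite le_eqVlt; apply/orP; left.
by apply/eqP; congr `| _ |; rewrite /dlap; ring.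
Qed.

Lemma dharmZ k h z : dharm h z -> dharm (fun x => k * h x) z.
Proof.
move=> [C [r r0 H]]; exists (`|k| * C), r => // t t0 tr.
rewrite -mulrA; apply: le_trans (ler_wpM2l (normr_ge0 k) (H t t0 tr)).
rewrite -normrM le_eqVlt; apply/orP; left.
by apply/eqP; congr `| _ |; rewrite /dlap; ring.
Qed.

Lemma dharm_cst (k : R) z : dharm (fun=> k) z.
Proof.
exists 0, 1 => // t _ _; rewrite mul0r /dlap.
by rewrite (_ : _ + _ = 0) ?normr0 //; ring.
Qed.

Lemma dharm_sum (I : Type) (s : seq I) (F : I -> R[i] -> R) z :
  (forall i, dharm (F i) z) -> dharm (fun x => \sum_(i <- s) F i x) z.
Proof.
move=> H; elim: s => [|i s IH].
  by apply: (dharm_ext (@dharm_cst 0 z)) => x; rewrite big_nil.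
by apply: (dharm_ext (dharmD (H i) IH)) => x; rewrite big_cons.
Qed.

Lemma taylor2_step phi z : taylor2 phi z ->
  exists c1 c2 : R[i], exists2 C : R, 0 <= C & exists2 r : R, 0 < r &
    forall t, 0 < t -> t < r -> forall u : R[i], cmod u = 1 ->
      cmod (phi (z + u * t%:C) -
        (phi z + c1 * (u * t%:C) + c2 * (u * t%:C) ^+ 2)) <= C * t ^+ 3.
Proof.
move=> [c1 [c2 [C [r r0 H]]]]; exists c1, c2, `|C| => //; exists r => // t t0 tr u u1.
have ut : cmod (u * t%:C) = t by rewrite cmodM cmodR u1 mul1r gtr0_norm.
have := H (u * t%:C); rewrite ut => /(_ tr) /le_trans -> //.
by rewrite ler_wpM2r ?exprn_ge0 ?ler_norm // ltW.
Qed.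

Lemma dlapE h z t : dlap h z t =
  h (z + 1 * t%:C) + h (z + 'i%C * t%:C) + h (z + (-1) * t%:C) + h (z + (- 'i%C) * t%:C)
  - 4 * h z.
Proof. by rewrite /dlap mul1r mulN1r mulNr. Qed.

(** The sums of i^k and of i^(2k) over k < 4 vanish, so the linear and quadratic Taylor terms cancel
    and four cubic remainders are left. *)
Lemma dharm_Re phi z : taylor2 phi z -> dharm (fun x => Re (phi x)) z.
Proof.
move=> /taylor2_step[c1 [c2 [C C0 [r r0 H]]]].
exists (4 * C), r => // t t0 tr.
have H1 := H t t0 tr 1 (cmod1 ).
have H2 := H t t0 tr 'i%C (cmodi).
have H3 := H t t0 tr (-1); rewrite cmodN cmod1 in H3; have {}H3 := H3 erefl.
have H4 := H t t0 tr (- 'i%C); rewrite cmodN cmodi in H4; have {}H4 := H4 erefl.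
rewrite dlapE.
move: H1 H2 H3 H4; set e1 := phi _ - _; set e2 := phi _ - _; set e3 := phi _ - _.
set e4 := phi _ - _ => H1 H2 H3 H4.
have i2 : 'i%C ^+ 2 = -1 :> R[i] := sqr_i R.
have E : phi (z + 1 * t%:C) + phi (z + 'i%C * t%:C) + phi (z + (-1) * t%:C) +
   phi (z + (- 'i%C) * t%:C) - 4 * phi z = e1 + e2 + e3 + e4.
  rewrite /e1 /e2 /e3 /e4 !exprMn !sqrrN i2; ring.
have -> : Re (phi (z + 1 * t%:C)) + Re (phi (z + 'i%C * t%:C)) +
   Re (phi (z + (-1) * t%:C)) + Re (phi (z + (- 'i%C) * t%:C)) - 4 * Re (phi z) =
   Re (e1 + e2 + e3 + e4).
  rewrite -E ReB !ReD; congr (_ - _).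
  by have := ReZ 4 (phi z); rewrite rmorph_nat => <-.
apply: le_trans (ler_Re_cmod _) _.
have := ler_cmodD (e1 + e2 + e3) e4; have := ler_cmodD (e1 + e2) e3.
have := ler_cmodD e1 e2; lra.
Qed.

(* [O3 u v]: u(t) = v(t) + O(t^3) as t -> 0+ *)
Let O3 (u v : R -> R[i]) := exists2 C : R, 0 <= C & exists2 r : R, 0 < r &
  forall t, 0 < t -> t < r -> cmod (u t - v t) <= C * t ^+ 3.
Let bnd (u : R -> R[i]) := exists2 C : R, 0 <= C &
  forall t, 0 < t -> t < 1 -> cmod (u t) <= C.

Let O3M u1 v1 u2 v2 : O3 u1 v1 -> O3 u2 v2 -> bnd v1 -> bnd v2 ->
  O3 (fun t => u1 t * u2 t) (fun t => v1 t * v2 t).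
Proof.
move=> [C1 C10 [r1 r10 H1]] [C2 C20 [r2 r20 H2]] [B1 B10 b1] [B2 B20 b2].
exists (C1 * (B2 + C2) + B1 * C2); first by rewrite addr_ge0 // mulr_ge0 // addr_ge0.
exists (Num.min 1 (Num.min r1 r2)); first by rewrite !lt_min r10 r20 ltr01.
move=> t t0; rewrite !lt_min => /andP[tl /andP[tr1 tr2]].
have h1 := H1 t t0 tr1; have h2 := H2 t t0 tr2.
have {b1} k1 := b1 t t0 tl; have {b2} k2 := b2 t t0 tl.
have t3 : t ^+ 3 <= 1 by rewrite exprn_ile1 // ltW.
have t30 : 0 <= t ^+ 3 by rewrite exprn_ge0 // ltW.
have -> : u1 t * u2 t - v1 t * v2 t = (u1 t - v1 t) * (v2 t + (u2 t - v2 t))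
   + v1 t * (u2 t - v2 t) by ring.
apply: le_trans (ler_cmodD _ _) _; rewrite !cmodM mulrDl; apply: lerD.
  rewrite mulrAC; apply: ler_pM; rewrite ?cmod_ge0 //.
  apply: le_trans (ler_cmodD _ _) _; apply: lerD => //.
  by apply: (le_trans h2); rewrite ler_piMr.
by rewrite -mulrA; apply: ler_pM; rewrite ?cmod_ge0.
Qed.

Let bndM u v : bnd u -> bnd v -> bnd (fun t => u t * v t).
Proof.
move=> [B1 B10 b1] [B2 B20 b2]; exists (B1 * B2); first exact: mulr_ge0.
move=> t t0 tl; rewrite cmodM; apply: ler_pM; rewrite ?cmod_ge0 //;
  [exact: b1 | exact: b2].
Qed.

Lemma ler_norm_ln (u : R) : `|u - 1| <= 2^-1 -> `|ln u| <= 2 * `|u - 1|.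
Proof.
rewrite ler_norml => /andP[h1 h2].
have u0 : 0 < u by lra.
have l1 : ln u <= u - 1.
  by have := le_ln1Dx (x := u - 1); rewrite addrCA subrr addr0 => ->//; lra.
have l2 : - ln u <= u^-1 - 1.
  rewrite -lnV ?posrE //; have v0 : 0 < u^-1 by rewrite invr_gt0.
  have := le_ln1Dx (x := u^-1 - 1); rewrite addrCA subrr addr0 => ->//; lra.
have l3 : u^-1 - 1 <= 2 * `|u - 1|.
  rewrite (_ : u^-1 - 1 = (1 - u) / u); last by field; lra.
  rewrite ler_pdivrMr // distrC; have := ler_norm (1 - u); have := normr_ge0 (1 - u).
  nra.
rewrite ler_norml; apply/andP; split; first lra.
by apply: (le_trans l1); have := ler_norm (u - 1); have := normr_ge0 (u - 1); lra.
Qed.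

(** No branch of the logarithm is taken: the discrete Laplacian of ln |phi| is the logarithm of the
    modulus of the product of the four values, divided by |phi z|^4. For the quadratic Taylor
    polynomial, the product over the fourth roots of unity contains only the powers t^0, t^4 and
    t^8, so the quotient is 1 + O(t^3). *)
Lemma dharm_ln phi z : taylor2 phi z -> phi z != 0 ->
  dharm (fun x => ln (cmod (phi x))) z.
Proof.
move=> /taylor2_step[c1 [c2 [C C0 [r r0 H]]]] nz.
pose q (u : R[i]) t := phi z + c1 * (u * t%:C) + c2 * (u * t%:C) ^+ 2.
have Ou u : cmod u = 1 -> O3 (fun t => phi (z + u * t%:C)) (q u).
  by move=> u1; exists C => //; exists r => // t t0 tr; exact: H.
have bq u : cmod u = 1 -> bnd (q u).
  move=> u1; exists (cmod (phi z) + cmod c1 + cmod c2).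
    by rewrite !addr_ge0 // cmod_ge0.
  move=> t t0 t1; apply: le_trans (ler_cmodD _ _) _; apply: lerD.
    apply: le_trans (ler_cmodD _ _) _; apply: lerD => //.
    rewrite !cmodM u1 cmodR gtr0_norm // mul1r ler_piMr ?cmod_ge0 // ltW //.
  rewrite cmodM cmodX !cmodM u1 cmodR gtr0_norm // mul1r ler_piMr ?cmod_ge0 //.
  by rewrite exprn_ile1 // ltW.
have h1 := cmod1 (R := R); have h2 := cmodi (R := R).
have h3 : cmod (-1 : R[i]) = 1 by rewrite cmodN.
have h4 : cmod (- 'i%C : R[i]) = 1 by rewrite cmodN.
have P := O3M (O3M (Ou _ h1) (Ou _ h2) (bq _ h1) (bq _ h2))
  (O3M (Ou _ h3) (Ou _ h4) (bq _ h3) (bq _ h4))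
  (bndM (bq _ h1) (bq _ h2)) (bndM (bq _ h3) (bq _ h4)).
have [B B0 PB] : exists2 B : R, 0 <= B & exists2 r' : R, 0 < r' & forall t, 0 < t -> t < r' ->
  cmod (phi (z + 1 * t%:C) * phi (z + 'i%C * t%:C) *
   (phi (z + -1 * t%:C) * phi (z + - 'i%C * t%:C)) - phi z ^+ 4) <= B * t ^+ 3.
  case: P => B B0 [r' r'0 PB].
  pose A := cmod (2 * phi z ^+ 2 * c2 ^+ 2 - (2 * phi z * c2 - c1 ^+ 2) ^+ 2).
  exists (B + (A + cmod (c2 ^+ 4))); first by rewrite !addr_ge0 // cmod_ge0.
  exists (Num.min 1 r'); first by rewrite lt_min ltr01.
  move=> t t0; rewrite lt_min => /andP[tl tr].
  have {PB} := PB t t0 tr.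
  set X := _ * (_ * _); set Y := q _ _ * _ * _ => h.
  have i2 : 'i%C ^+ 2 = -1 :> R[i] := sqr_i R.
  have Q u : q u t * q (- u) t =
      (phi z + c2 * u ^+ 2 * t%:C ^+ 2) ^+ 2 - c1 ^+ 2 * u ^+ 2 * t%:C ^+ 2.
    by rewrite /q; ring.
  have EY : Y = phi z ^+ 4 + ((2 * phi z ^+ 2 * c2 ^+ 2 -
      (2 * phi z * c2 - c1 ^+ 2) ^+ 2) * t%:C ^+ 4 + c2 ^+ 4 * t%:C ^+ 8).
    by rewrite /Y mulrACA !Q i2; ring.
  have {EY} -> : X - phi z ^+ 4 = (X - Y) + ((2 * phi z ^+ 2 * c2 ^+ 2 -
      (2 * phi z * c2 - c1 ^+ 2) ^+ 2) * t%:C ^+ 4 + c2 ^+ 4 * t%:C ^+ 8).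
    by rewrite EY; ring.
  rewrite /A; set k1 := 2 * _ * _ - _; set k2 := c2 ^+ 4; move: k1 k2 => k1 k2.
  apply: le_trans (ler_cmodD _ _) _; rewrite mulrDl; apply: lerD => //.
  apply: le_trans (ler_cmodD _ _) _; rewrite mulrDl !(cmodM _ (_ ^+ _)).
  rewrite !cmodX !cmodR !gtr0_norm //.
  by apply: lerD; apply: ler_wpM2l; rewrite ?cmod_ge0 // ler_wiXn2l // ltW.
case: PB => r' r'0 PB.
pose m := cmod (phi z) ^+ 4.
have m0 : 0 < m by rewrite exprn_gt0 // cmod_gt0.
pose r'' := Num.min 1 (Num.min r' (m / (2 * (B + 1)))).
exists (2 * (B / m)), r''.
  by rewrite !lt_min ltr01 r'0 divr_gt0 // mulr_gt0 //; lra.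
move=> t t0; rewrite !lt_min => /andP[t1 /andP[tr]].
rewrite ltr_pdivlMr; last by lra.
move=> tm; have {PB} := PB t t0 tr.
set p1 := phi _; set p2 := phi _; set p3 := phi _; set p4 := phi _ => PB.
have t3 : t ^+ 3 <= t by rewrite -{2}(expr1 t) ler_wiXn2l // ltW.
have t30 : 0 <= t ^+ 3 by rewrite exprn_ge0 // ltW.
pose u := cmod (p1 * p2 * (p3 * p4)) / m.
have hu : `|u - 1| <= B / m * t ^+ 3.
  rewrite /u -[X in _ - X](divff (lt0r_neq0 m0)) -mulrBl normrM normfV.
  rewrite (gtr0_norm m0) ler_pdivrMr // (_ : _ * m = B * t ^+ 3); last first.
    by field; rewrite (lt0r_neq0 m0).
  by apply: le_trans PB; rewrite /m -cmodX; exact: ler_cmod_dist.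
have hu2 : `|u - 1| <= 2^-1.
  apply: (le_trans hu); rewrite mulrAC ler_pdivrMr //; nra.
have u0 : 0 < u by move: hu2; rewrite ler_norml; lra.
have : 0 < cmod (p1 * p2 * (p3 * p4)).
  by rewrite -(divfK (lt0r_neq0 m0) (cmod _)) mulr_gt0.
rewrite cmod_gt0 !mulf_eq0 !negb_or => /andP[/andP[n1 n2] /andP[n3 n4]].
rewrite dlapE (_ : _ - _ = ln u); first by
  apply: le_trans (ler_norm_ln hu2) _; rewrite -mulrA ler_wpM2l.
rewrite /u ln_div ?posrE ?cmod_gt0 ?mulf_neq0 // /m lnXn ?cmod_gt0 //.
move: n1 n2 n3 n4; rewrite /p1 /p2 /p3 /p4 => n1 n2 n3 n4.
rewrite !cmodM !lnM ?posrE ?mulr_gt0 ?cmod_gt0 //; ring.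
Qed.

End DiscreteLaplacian.

(** * Taylor expansions, continuity, and functions that are continuous and discretely harmonic *)

Section Taylor.
Context {R : realType}.
Implicit Types (x y z w : R[i]) (a b t : R).

(** Convergence at z0 + s bounds the terms c_k s^k, and within s / 2 the tail is dominated by a
    geometric series. One radius and one constant serve all n: n = 1 identifies c_0 with the value
    of f, n = 3 gives [taylor2], and n = m gives the decay at a zero of order m. *)
Lemma pseries_remainder (f : R[i] -> R[i]) (c : nat -> R[i]) z0 (rho : R) :
  cmod z0 < 1 -> 0 < rho ->
  (forall z, cmod (z - z0) < rho -> cmod z < 1 -> pseries_to c z0 z (f z)) ->
  exists2 M : R, 0 <= M & exists2 r : R, 0 < r & forall n h, cmod h <= r ->
    cmod (f (z0 + h) - \sum_(k < n) c k * h ^+ k) <= M * (cmod h / r) ^+ n.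
Proof.
move=> z01 rho0 H.
pose s := Num.min rho (1 - cmod z0) / 2.
have m0 : 0 < Num.min rho (1 - cmod z0) by rewrite lt_min rho0 subr_gt0.
have s0 : 0 < s by rewrite divr_gt0.
have [s1 s2] : s < rho /\ s < 1 - cmod z0.
  have : s < Num.min rho (1 - cmod z0) by rewrite /s; lra.
  by rewrite lt_min => /andP[].
have in_dom h : cmod h <= s -> pseries_to c z0 (z0 + h) (f (z0 + h)).
  move=> hs; apply: H; first by rewrite addrC addKr; lra.
  by apply: le_lt_trans (ler_cmodD _ _) _; lra.
have [B B0 HB] : exists2 B : R, 0 <= B & forall k, cmod (c k) * s ^+ k <= B.
  have hs : cmod (s%:C : R[i]) = s by rewrite cmodR gtr0_norm.
  have cv := in_dom s%:C; rewrite hs in cv; have {}cv := cv (lexx _).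
  have /cvg_seq_bounded[D [Dr HD]] : cvgn (fun N : nat => cmod (\sum_(k < N) c k * (z0 + s%:C - z0) ^+ k - f (z0 + s%:C)))
    by apply/cvg_ex; exists 0; exact: cv.
  have hD : D < `|D| + 1 by have := ler_norm D; lra.
  have {}HD := HD _ hD.
  exists (2 * (`|D| + 1)); first by have := normr_ge0 D; lra.
  move=> k.
  have e1 := HD k I; have e2 := HD k.+1 I; move: e1 e2 => /=.
  rewrite ![`|cmod _|]ger0_norm ?cmod_ge0 // big_ord_recr /= (addrC z0) addrK.
  set S := \sum_(_ < _) _; set w := f _ => e1 e2.
  rewrite -[s in s ^+ _]hs -cmodX -cmodM.
  rewrite (_ : c k * _ = (S + c k * s%:C ^+ k - w) - (S - w)); last by ring.
  by apply: le_trans (ler_cmodB _ _) _; lra.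
exists (2 * B); first by rewrite mulr_ge0.
exists (s / 2); first by rewrite divr_gt0.
move=> n h hs.
set q := cmod h / s.
have q0 : 0 <= q by rewrite divr_ge0 ?cmod_ge0 // ltW.
have q2 : q <= 2^-1 by rewrite ler_pdivrMr // mulrC.
(* The subtracted term q^N * 2 lets the induction close; its step uses q <= 1/2. *)
have tail N : \sum_(n <= k < n + N) cmod (c k * h ^+ k) <= B * q ^+ n * (2 - q ^+ N * 2).
  elim: N => [|N IH]; first by rewrite addn0 big_geq // expr0 mul1r subrr mulr0.
  rewrite addnS big_nat_recr ?leq_addr //=; apply: le_trans (lerD IH (lexx _)) _.
  have -> : cmod (c (n + N)%N * h ^+ (n + N)) = cmod (c (n + N)%N) * s ^+ (n + N) * q ^+ (n + N).
    by rewrite cmodM cmodX -mulrA -exprMn mulrCA divff ?mulr1 // lt0r_neq0.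
  have := ler_wpM2r (exprn_ge0 (n + N) q0) (HB (n + N)%N).
  rewrite [q ^+ N.+1]exprS [q ^+ (n + N)]exprD => hh; apply: le_trans (lerD (lexx _) hh) _.
  rewrite -subr_ge0 (_ : _ - _ = B * q ^+ n * q ^+ N * (1 - 2 * q)); last by ring.
  by rewrite !mulr_ge0 ?exprn_ge0 //; lra.
have key N : cmod (\sum_(k < n + N) c k * h ^+ k - \sum_(k < n) c k * h ^+ k) <= 2 * B * q ^+ n.
  rewrite -!(big_mkord xpredT (fun k => c k * h ^+ k)) (big_cat_nat _ (n := n)) ?leq_addr //=.
  rewrite addrAC subrr add0r; apply: le_trans (cmod_sum _ _ _) _.
  apply: le_trans (tail N) _; rewrite (_ : 2 * B * q ^+ n = B * q ^+ n * 2); last by ring.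
  rewrite ler_wpM2l //.
    by rewrite mulr_ge0 ?exprn_ge0.
  by have := exprn_ge0 N q0; lra.
have hs' : cmod h <= s by apply: le_trans hs _; lra.
have qn : 2 * B * q ^+ n <= 2 * B * (cmod h / (s / 2)) ^+ n.
  rewrite ler_wpM2l ?mulr_ge0 // lerXn2r ?nnegrE //.
    by rewrite divr_ge0 ?cmod_ge0 ?divr_ge0 // ltW.
  rewrite ler_wpM2l ?cmod_ge0 // lef_pV2 ?posrE //; first by lra.
  by rewrite divr_gt0.
apply: (le_trans _ qn); apply/ler_addgt0Pr => e e0.
have := in_dom h hs'; rewrite /pseries_to => /cvgrPdist_lt /(_ e e0)[N _ /(_ (n + N)%N)] /=.
rewrite leq_addl => /(_ isT); rewrite sub0r normrN ger0_norm ?cmod_ge0 //.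
have -> : z0 + h - z0 = h by rewrite addrC addKr.
move=> hN.
rewrite (_ : _ - _ = (\sum_(k < n + N) c k * h ^+ k - \sum_(k < n) c k * h ^+ k)
  - (\sum_(k < n + N) c k * h ^+ k - f (z0 + h))); last by ring.
apply: le_trans (ler_cmodB _ _) _; apply: lerD (key N) _; first exact: ltW.
Qed.

Lemma analytic_taylor2 f z : analytic_on_disk f -> cmod z < 1 -> taylor2 f z.
Proof.
move=> fa z1; have [rho rho0 [c H]] := fa z z1.
have [M M0 [r r0 hr]] := pseries_remainder z1 rho0 H.
have c0 : f z = c 0%N.
  have := hr 1%N 0; rewrite cmod0 mul0r expr1 mulr0 addr0 big_ord1 expr0 mulr1.
  move=> /(_ (ltW r0)) h; apply/eqP; rewrite -subr_eq0 -cmod_eq0 eq_le h /=.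
  exact: cmod_ge0.
exists (c 1%N), (c 2%N), (M / r ^+ 3), r => // h /ltW hh.
have := hr 3%N h hh; rewrite !big_ord_recr big_ord0 /= add0r expr0 mulr1 expr1 -c0.
by move/le_trans; apply; rewrite expr_div_n mulrCA [cmod h ^+ 3 * _]mulrC.
Qed.

Lemma zero_order_bound f z m : cmod z < 1 -> zero_order f z m ->
  exists2 C : R, 0 <= C & exists2 r : R, 0 < r & forall h, cmod h <= r ->
    cmod (f (z + h)) <= C * cmod h ^+ m.
Proof.
move=> z1 [rho rho0 [c [cm _ H]]].
have [M M0 [r r0 hr]] := pseries_remainder z1 rho0 H.
exists (M / r ^+ m); first by rewrite divr_ge0 // exprn_ge0 // ltW.
exists r => // h hh; have := hr m h hh.
rewrite big1 ?subr0 => [/le_trans->//|k _]; last by rewrite cm ?mul0r.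
by rewrite expr_div_n mulrCA [cmod h ^+ m * _]mulrC.
Qed.

Lemma taylor2_affine (u v : R[i]) z : taylor2 (fun x => u + v * x) z.
Proof.
exists v, 0, 0, 1 => // h _; rewrite (_ : _ - _ = 0) ?cmod0 ?mul0r //; ring.
Qed.

Lemma taylor2_inv_affine (u v : R[i]) z : u + v * z != 0 ->
  taylor2 (fun x => (u + v * x)^-1) z.
Proof.
set w := u + v * z => w0.
exists (- v / w ^+ 2), (v ^+ 2 / w ^+ 3), (2 * cmod v ^+ 3 / cmod w ^+ 4).
have cw : 0 < cmod w by rewrite cmod_gt0.
exists (cmod w / (2 * (cmod v + 1))).
  by rewrite divr_gt0 // mulr_gt0 // ltr_wpDl ?cmod_ge0.
move=> h; rewrite ltr_pdivlMr; last by rewrite mulr_gt0 // ltr_wpDl ?cmod_ge0.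
move=> hh.
have hv : cmod v * cmod h <= cmod w / 2.
  by have := cmod_ge0 v; have := cmod_ge0 h; nra.
have hw : cmod w / 2 <= cmod (w + v * h).
  rewrite (_ : w + v * h = w - (- (v * h))); last by ring.
  have := ler_cmod_dist w (- (v * h)); rewrite cmodN cmodM => /(le_trans (ler_norm _)).
  lra.
have wh0 : w + v * h != 0 by rewrite -cmod_gt0; lra.
rewrite /= -/w (_ : u + v * (z + h) = w + v * h); last by rewrite /w; ring.
rewrite (_ : _ - _ = - (v ^+ 3 * h ^+ 3) / (w ^+ 3 * (w + v * h))); last first.
  by field; rewrite wh0 w0.
rewrite cmodM cmodV cmodN (cmodM (v ^+ 3)) (cmodM (w ^+ 3)) !cmodX ler_pdivrMr ?mulr_gt0 ?exprn_gt0 ?cmod_gt0 //.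
rewrite [leRHS](_ : _ = cmod v ^+ 3 * cmod h ^+ 3 * (2 * cmod (w + v * h) / cmod w)); last first.
  by field; rewrite lt0r_neq0.
by rewrite ler_peMr ?mulr_ge0 ?exprn_ge0 ?cmod_ge0 // ler_pdivlMr //; lra.
Qed.

(* continuity at [z], through the identification of [R[i]] with [R * R] *)
Definition ccont (h : R[i] -> R) z : Prop :=
  {for (Re z, Im z), continuous (fun p : R * R => h (p.1 +i* p.2))}.

Lemma ccontP (h : R[i] -> R) z : ccont h z <->
  forall e : R, 0 < e -> exists2 r : R, 0 < r &
    forall x, cmod x < r -> `|h (z + x) - h z| < e.
Proof.
have zE : z = Re z +i* Im z by case: (z).
split=> [/cvgrPdist_lt H e e0|H].
  have [[/= A B] [/nbhs_ballP[r1 /= r10 h1] /nbhs_ballP[r2 /= r20 h2]] AB] := H e e0.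
  exists (Num.min r1 r2); first by rewrite lt_min r10.
  move=> x; rewrite lt_min => /andP[x1 x2].
  have := AB (Re (z + x), Im (z + x)); rewrite /= -zE distrC => hx.
  have -> : z + x = Re (z + x) +i* Im (z + x) by case: (z + x).
  apply: hx; split => /=; [apply: h1 | apply: h2]; rewrite /ball /= distrC.
    by apply: le_lt_trans x1; rewrite -ReB addrC addKr; exact: ler_Re_cmod.
  apply: le_lt_trans x2; rewrite -ImB addrC addKr; exact: ler_Im_cmod.
rewrite /ccont /continuous_at /=; apply/cvgrPdist_lt => e /H[r r0 {}H].
have d0 : 0 < r / 2 by rewrite divr_gt0.
near=> p.
have h1 : `|Re z - p.1| < r / 2.
  by near: p; apply: cvgr_dist_lt => //; exact: cvg_fst.
have h2 : `|Im z - p.2| < r / 2.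
  by near: p; apply: cvgr_dist_lt => //; exact: cvg_snd.
pose x := (p.1 - Re z) +i* (p.2 - Im z).
have xE : p.1 +i* p.2 = z + x.
  by rewrite [in RHS]zE /x /=; congr (_ +i* _); rewrite addrC subrK.
rewrite -zE xE distrC; apply: H.
have -> : x = (p.1 - Re z)%:C + 'i%C * (p.2 - Im z)%:C by exact: complexE.
apply: le_lt_trans (ler_cmodD _ _) _; rewrite cmodM cmodi !cmodR mul1r.
by rewrite distrC [X in _ + X]distrC; lra.
Unshelve. all: by end_near.
Qed.

Lemma lip_ccont (h : R[i] -> R) z (C r : R) : 0 < r ->
  (forall x, cmod x < r -> `|h (z + x) - h z| <= C * cmod x) -> ccont h z.
Proof.
move=> r0 H; apply/ccontP => e e0.
have C1 : 0 < `|C| + 1 by have := normr_ge0 C; lra.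
exists (Num.min r (e / (`|C| + 1))); first by rewrite lt_min r0 divr_gt0.
move=> x; rewrite lt_min ltr_pdivlMr // => /andP[xr xe].
apply: le_lt_trans (H x xr) _.
apply: le_lt_trans (ler_wpM2r (cmod_ge0 x) (ler_norm C)) _.
have := cmod_ge0 x; nra.
Qed.

Lemma taylor2_lip phi z : taylor2 phi z -> exists C : R, exists2 r : R, 0 < r &
  forall x, cmod x < r -> cmod (phi (z + x) - phi z) <= C * cmod x.
Proof.
move=> [c1 [c2 [C [r r0 H]]]].
exists (cmod c1 + cmod c2 + `|C|), (Num.min 1 r); first by rewrite lt_min ltr01.
move=> x; rewrite lt_min => /andP[x1 xr].
rewrite (_ : _ - _ = (phi (z + x) - (phi z + c1 * x + c2 * x ^+ 2)) +
  c1 * x + c2 * x ^+ 2); last by ring.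
have x0 := cmod_ge0 x.
have x2 : cmod x ^+ 2 <= cmod x by rewrite expr2 ler_piMr // ltW.
have x3 : cmod x ^+ 3 <= cmod x.
  by rewrite exprS ler_piMr // exprn_ile1 // ltW.
apply: le_trans (ler_cmodD _ _) _; apply: le_trans (lerD (ler_cmodD _ _) (lexx _)) _.
rewrite (cmodM c1) (cmodM c2) cmodX.
have h1 := ler_wpM2l (cmod_ge0 c2) x2.
have h2 := ler_wpM2l (normr_ge0 C) x3.
have h3 := ler_wpM2r (exprn_ge0 3 x0) (ler_norm C).
by have := H x xr; rewrite !mulrDl; lra.
Qed.

Lemma ccont_cmod phi z : taylor2 phi z -> ccont (fun x => cmod (phi x)) z.
Proof.
move=> /taylor2_lip[C [r r0 H]]; apply: (lip_ccont r0) => x xr.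
by apply: le_trans (H x xr); exact: ler_cmod_dist.
Qed.

Lemma ccont_Re phi z : taylor2 phi z -> ccont (fun x => Re (phi x)) z.
Proof.
move=> /taylor2_lip[C [r r0 H]]; apply: (lip_ccont r0) => x xr.
by apply: le_trans (H x xr); rewrite -ReB; exact: ler_Re_cmod.
Qed.

Lemma ccont_comp (g : R -> R) h z : ccont h z -> {for h z, continuous g} ->
  ccont (fun x => g (h x)) z.
Proof.
move=> hz gz; rewrite /ccont; apply: (@continuous_comp _ _ _ _ g _ hz).
by case: z gz {hz}.
Qed.

Lemma ccontD h1 h2 z : ccont h1 z -> ccont h2 z -> ccont (fun x => h1 x + h2 x) z.
Proof. by move=> c1 c2; apply: continuousD. Qed.

Lemma ccontM h1 h2 z : ccont h1 z -> ccont h2 z -> ccont (fun x => h1 x * h2 x) z.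
Proof. by move=> c1 c2; apply: continuousM. Qed.

Lemma ccont_min h1 h2 z : ccont h1 z -> ccont h2 z ->
  ccont (fun x => Num.min (h1 x) (h2 x)) z.
Proof. by move=> c1 c2; apply: (@continuous_min R). Qed.

Lemma ccont_max h1 h2 z : ccont h1 z -> ccont h2 z ->
  ccont (fun x => Num.max (h1 x) (h2 x)) z.
Proof. by move=> c1 c2; apply: (@continuous_max R). Qed.

Lemma ccont_cst (k : R) z : ccont (fun=> k) z.
Proof. exact: cst_continuous. Qed.

Lemma ccont_sum (I : Type) (s : seq I) (F : I -> R[i] -> R) z :
  (forall i, ccont (F i) z) -> ccont (fun x => \sum_(i <- s) F i x) z.
Proof.
move=> H; elim: s => [|i s IH].
  rewrite (_ : (fun x => _) = fun=> 0); first exact: ccont_cst.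
  by apply/funext => x; rewrite big_nil.
rewrite (_ : (fun x => _) = fun x => F i x + \sum_(j <- s) F j x); first exact: ccontD.
by apply/funext => x; rewrite big_cons.
Qed.

Definition regular_at (h : R[i] -> R) z : Prop := dharm h z /\ ccont h z.

Lemma regular_ln phi z : taylor2 phi z -> phi z != 0 ->
  regular_at (fun x => ln (cmod (phi x))) z.
Proof.
move=> t n; split; first exact: dharm_ln.
apply: ccont_comp; first exact: ccont_cmod.
by apply: continuous_ln; rewrite cmod_gt0.
Qed.

Lemma regular_Re phi z : taylor2 phi z -> regular_at (fun x => Re (phi x)) z.
Proof. by move=> t; split; [exact: dharm_Re | exact: ccont_Re]. Qed.

Lemma regularD h1 h2 z : regular_at h1 z -> regular_at h2 z ->
  regular_at (fun x => h1 x + h2 x) z.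
Proof. by move=> [? ?] [? ?]; split; [exact: dharmD | exact: ccontD]. Qed.

Lemma regularZ (k : R) h z : regular_at h z -> regular_at (fun x => k * h x) z.
Proof.
move=> [? ?]; split; first exact: dharmZ.
by apply: ccontM => //; exact: ccont_cst.
Qed.

Lemma regular_sum (I : Type) (s : seq I) (F : I -> R[i] -> R) z :
  (forall i, regular_at (F i) z) -> regular_at (fun x => \sum_(i <- s) F i x) z.
Proof.
by move=> H; split; [apply: dharm_sum | apply: ccont_sum] => i; case: (H i).
Qed.

End Taylor.

(** * Maximum principle and a Jensen-type bound for a finite list of zeros *)

Section MaximumPrinciple.
Context {R : realType}.
Implicit Types (x y z w zeta : R[i]) (a b t : R).

(** The maximum over the compact set where g >= 0 is attained either where g = 0 or, by continuity
    of g, at a local maximum. Local maxima are excluded only where G exceeds 1; in the application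
    this keeps away from the zeros of f, where G = 0 and ln G makes no sense. *)
Lemma max_principle (G g : R[i] -> R) :
  (forall z, ccont g z) -> (forall z, 0 <= g z -> cmod z <= 1) ->
  (forall z, 0 <= g z -> ccont G z) -> (forall z, g z = 0 -> G z <= 1) ->
  (forall z, 0 < g z -> 1 < G z ->
     ~ exists2 r : R, 0 < r & forall h, cmod h < r -> G (z + h) <= G z) ->
  forall z, 0 <= g z -> G z <= 1.
Proof.
move=> gc g1 Gc Gb Gi z0 gz0.
pose P (p : R * R) : R[i] := p.1 +i* p.2.
pose A := [set p : R * R | 0 <= g (P p)].
have gcont : continuous (g \o P) by move=> [u v]; exact: (gc (u +i* v)).
have Acl : closed A.
  have -> : A = (g \o P) @^-1` [set t | 0 <= t] by [].
  by apply: preimage_closed => //; exact: closed_ge.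
have Acpt : compact A.
  apply: (subclosed_compact Acl (compact_setX (@segment_compact R (-1) 1) (@segment_compact R (-1) 1))).
  move=> [u v] /= /g1 h; rewrite !in_itv /= -!ler_norml; split; apply: le_trans h.
    exact: (ler_Re_cmod (u +i* v)).
  exact: (ler_Im_cmod (u +i* v)).
have A0 : A !=set0 by exists (Re z0, Im z0); rewrite /A /= /P /=; case: z0 gz0.
have Gcont : {within A, continuous (G \o P)}.
  apply: continuous_in_subspaceT => -[u v] /set_mem /= h; exact: (Gc (u +i* v)).
have [[u v] /set_mem cA cmax] := compact_EVT_max A0 Acpt Gcont.
set w : R[i] := u +i* v.
have gw : 0 <= g w by [].
have wmax z : 0 <= g z -> G z <= G w.
  case: z => x y h; have := cmax (x, y); apply; rewrite inE; exact: h.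
apply: le_trans (wmax _ gz0) _; rewrite leNgt; apply/negP => Gw.
move: gw; rewrite le_eqVlt => /orP[/eqP/esym/Gb|gw]; first by rewrite leNgt Gw.
apply: (Gi w gw Gw).
have /ccontP/(_ _ gw)[r r0 hr] := gc w; exists r => // h /hr.
rewrite ltr_norml => /andP[h1 _]; apply: wmax; lra.
Qed.

Definition ln_blaschke zeta z : R :=
  ln (cmod (z - zeta)) - ln (cmod (1 - zeta^* * z)).

(** Divided by the left-hand side, this is the formula 1 - |b|^2 = (1 - |z|^2) (1 - |zeta|^2) / |1 -
    conj(zeta) z|^2 for the Blaschke factor b. *)
Lemma blaschke_id zeta z : cmod (1 - zeta^* * z) ^+ 2 =
  cmod (z - zeta) ^+ 2 + (1 - cmod z ^+ 2) * (1 - cmod zeta ^+ 2).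
Proof. by rewrite !sqr_cmod; case: z; case: zeta => a b c d /=; ring. Qed.

Lemma conj_affine_gt0 zeta z : cmod zeta <= 1 -> cmod z < 1 -> 0 < cmod (1 - zeta^* * z).
Proof.
move=> h1 h2; have := ler_cmod_dist 1 (zeta^* * z).
rewrite cmod1 cmodM cmod_conj => /(le_trans (ler_norm _)).
have := cmod_ge0 z; have := cmod_ge0 zeta; nra.
Qed.

Lemma cmod_blaschke_le zeta z : cmod zeta <= 1 -> cmod z <= 1 ->
  cmod (z - zeta) <= cmod (1 - zeta^* * z).
Proof.
move=> h1 h2; rewrite -(@ler_pXn2r _ 2%N) ?nnegrE ?cmod_ge0 // blaschke_id lerDl.
by rewrite mulr_ge0 // subr_ge0 exprn_ile1 // cmod_ge0.
Qed.

Lemma ln_blaschke_le0 zeta z : cmod zeta <= 1 -> cmod z < 1 -> z != zeta ->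
  ln_blaschke zeta z <= 0.
Proof.
move=> h1 h2 h3; rewrite subr_le0 ler_ln ?posrE.
- exact: cmod_blaschke_le (ltW _).
- by rewrite cmod_gt0 subr_eq0.
- exact: conj_affine_gt0.
Qed.

Lemma regular_ln_sub zeta z : z != zeta -> regular_at (fun x => ln (cmod (x - zeta))) z.
Proof.
move=> h; apply: (@regular_ln _ (fun x => x - zeta)); last by rewrite subr_eq0.
have := taylor2_affine (- zeta) 1 z; congr (taylor2 _ _).
by apply/funext => x; rewrite mul1r addrC.
Qed.

Lemma regular_ln_conj zeta z : cmod zeta <= 1 -> cmod z < 1 ->
  regular_at (fun x => ln (cmod (1 - zeta^* * x))) z.
Proof.
move=> h1 h2; apply: (@regular_ln _ (fun x => 1 - zeta^* * x)).
  have := taylor2_affine 1 (- zeta^*) z; congr (taylor2 _ _).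
  by apply/funext => x; rewrite mulNr.
by rewrite -cmod_gt0; exact: conj_affine_gt0.
Qed.

Lemma dlap_sqr_cmod z t : dlap (fun x => cmod x ^+ 2) z t = 4 * t ^+ 2.
Proof. by rewrite /dlap !sqr_cmod; case: z => u v /=; ring. Qed.

Lemma ccont_cmod_id z : ccont (fun x => cmod x) z.
Proof.
apply: (@lip_ccont _ _ _ 1 1) => // x _; rewrite mul1r.
by apply: le_trans (ler_cmod_dist _ _) _; rewrite addrC addKr.
Qed.

Lemma ccont_sqr_cmod z : ccont (fun x => cmod x ^+ 2) z.
Proof.
by rewrite (_ : (fun x => _) = fun x => cmod x * cmod x) //; apply: ccontM; exact: ccont_cmod_id.
Qed.

Lemma zero_order_root f zeta m : cmod zeta < 1 -> zero_order f zeta m -> (0 < m)%N ->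
  f zeta = 0.
Proof.
move=> z1 zo m0; have [C C0 [r r0 /(_ 0)]] := zero_order_bound z1 zo.
rewrite cmod0 addr0 expr0n (gtn_eqF m0) mulr0.
move=> /(_ (ltW r0)) h; apply/eqP; rewrite -cmod_eq0 eq_le h; exact: cmod_ge0.
Qed.

Section JensenBound.
Variables (f : R[i] -> R[i]) (Z : seq R[i]) (g : R[i] -> R).
Variables (Psi : R[i] -> R[i] -> R) (Phi : R[i] -> R).
Hypotheses (fa : analytic_on_disk f) (f0 : cmod (f 0) = 1).
Hypotheses (gc : forall z, ccont g z) (g1 : forall z, 0 <= g z -> cmod z < 1).
Hypothesis g0 : 0 <= g 0.
Hypothesis Z1 : forall zeta, zeta \in Z -> cmod zeta < 1.
Hypothesis Zf : forall zeta, zeta \in Z ->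
  exists2 m, zero_order f zeta m & (count_mem zeta Z <= m)%N.
Hypothesis PsiR : forall zeta z, zeta \in Z -> cmod z < 1 -> regular_at (Psi zeta) z.
Hypothesis PhiR : forall z, cmod z < 1 -> regular_at Phi z.
Hypothesis Psib : forall zeta z, zeta \in Z -> g z = 0 ->
  0 <= ln_blaschke zeta z + Psi zeta z.
Hypothesis Phib : forall z, g z = 0 -> f z != 0 -> ln (cmod (f z)) <= Phi z.

Let Zf0 zeta : zeta \in Z -> f zeta = 0.
Proof.
move=> hz; have [m zo cm] := Zf hz.
by apply: (zero_order_root (Z1 hz) zo); apply: leq_trans cm; rewrite -has_count has_pred1.
Qed.

Section Kappa.
Variable kap : R.
Hypothesis kap0 : 0 < kap.

(* The exponent [1 - kap < 1] makes [G] tend to 0 at the points of [Z], so that no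
   division of [f] by its zeros is needed, and [kap * (1 - |z|^2)] makes [ln G]
   strictly subharmonic. *)
Let W0 z := \sum_(zeta <- Z) ((1 - kap) * ln_blaschke zeta z + Psi zeta z) + Phi z.
Let W z := W0 z + kap * (1 - cmod z ^+ 2).
Let G z := cmod (f z) * expR (- W z).

Let W0R z : cmod z < 1 -> z \notin Z -> regular_at W0 z.
Proof.
move=> z1 zZ; apply: regularD (PhiR z1).
have -> : (fun x => \sum_(zeta <- Z) ((1 - kap) * ln_blaschke zeta x + Psi zeta x)) =
  fun x => \sum_(zeta <- Z) (if zeta \in Z then (1 - kap) * ln_blaschke zeta x + Psi zeta x else 0).
  by apply/funext => x; apply: eq_big_seq => zeta ->.
apply: regular_sum => zeta; case: (boolP (zeta \in Z)) => hz; last first.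
  by split; [exact: dharm_cst | exact: ccont_cst].
apply: regularD (PsiR hz z1); apply: regularZ.
apply: regularD; first by apply: regular_ln_sub; apply: contraNneq zZ => ->.
have := regularZ (-1) (regular_ln_conj (ltW (Z1 hz)) z1); congr (regular_at _ _).
by apply/funext => x; rewrite mulN1r.
Qed.

Let ccontW z : ccont W0 z -> ccont W z.
Proof.
move=> h; apply: ccontD => //; apply: ccontM; first exact: ccont_cst.
rewrite (_ : (fun x => _) = fun x => 1 + (-1) * cmod x ^+ 2).
  by apply: ccontD; [|apply: ccontM]; [exact: ccont_cst..|exact: ccont_sqr_cmod].
by apply/funext => x; rewrite mulN1r.
Qed.

(** If zeta occurs n times in Z, then f is O(|x|^n) at zeta + x, while exp(-W) grows only like
    |x|^(-n (1 - kap)); so G is O(|x|^(n kap)). *)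
Let G_near_zero zeta : zeta \in Z -> ccont G zeta.
Proof.
move=> hz; apply/ccontP => e e0.
have G0 : G zeta = 0 by rewrite /G Zf0 // cmod0 mul0r.
have [m zo cm] := Zf hz.
have [C C0 [r r0 hC]] := zero_order_bound (Z1 hz) zo.
have n0 : (0 < count_mem zeta Z)%N by rewrite -has_count has_pred1.
set n := count_mem zeta Z in cm n0.
(* [W0] with the singular terms ln |z - zeta| struck out; it is continuous at zeta. *)
pose V0 z := \sum_(xi <- Z) ((1 - kap) * ((if xi == zeta then 0 else ln (cmod (z - xi)))
   - ln (cmod (1 - xi^* * z))) + Psi xi z) + Phi z.
have VR : ccont V0 zeta.
  suff [] : regular_at V0 zeta by [].
  have z1 := Z1 hz.
  apply: regularD (PhiR z1).
  have -> : (fun z => \sum_(xi <- Z) ((1 - kap) * ((if xi == zeta then 0 else ln (cmod (z - xi)))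
     - ln (cmod (1 - xi^* * z))) + Psi xi z)) =
     fun z => \sum_(xi <- Z) (if xi \in Z then (1 - kap) * ((if xi == zeta then 0 else ln (cmod (z - xi)))
     - ln (cmod (1 - xi^* * z))) + Psi xi z else 0).
    by apply/funext => x; apply: eq_big_seq => xi ->.
  apply: regular_sum => xi; case: (boolP (xi \in Z)) => hxi; last first.
    by split; [exact: dharm_cst | exact: ccont_cst].
  apply: regularD (PsiR hxi z1); apply: regularZ; apply: regularD.
    case: (eqVneq xi zeta) => [_|ne]; first by split; [exact: dharm_cst | exact: ccont_cst].
    by apply: regular_ln_sub; rewrite eq_sym.
  have := regularZ (-1) (regular_ln_conj (ltW (Z1 hxi)) z1); congr (regular_at _ _).
  by apply/funext => x; rewrite mulN1r.
pose V z := V0 z + kap * (1 - cmod z ^+ 2).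
have WV z : W z = n%:R * (1 - kap) * ln (cmod (z - zeta)) + V z.
  rewrite /W /V addrA; congr (_ + _); rewrite /W0 /V0 addrA; congr (_ + _).
  have -> : n%:R * (1 - kap) * ln (cmod (z - zeta)) =
    \sum_(xi <- Z) (xi == zeta)%:R * ((1 - kap) * ln (cmod (z - zeta))).
    rewrite -big_distrl /= -natr_sum -mulrA; congr (_%:R * _).
    by rewrite /n -sum1_count big_mkcond /=; apply: eq_bigr => xi _; case: eqP.
  rewrite -big_split /=; apply: eq_bigr => xi _; rewrite addrA; congr (_ + _).
  by rewrite /ln_blaschke; case: eqP => [->|_]; rewrite ?mul1r ?mul0r; ring.
have Vc : ccont V zeta.
  apply: ccontD => //; apply: ccontM; first exact: ccont_cst.
  rewrite (_ : (fun x => _) = fun x => 1 + (-1) * cmod x ^+ 2).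
    by apply: ccontD; [|apply: ccontM]; [exact: ccont_cst..|exact: ccont_sqr_cmod].
  by apply/funext => x; rewrite mulN1r.
have /ccontP/(_ 1 ltr01)[r1 r10 hV] := Vc.
pose D := (C + 1) * expR (1 - V zeta).
have D0 : 0 < D by rewrite mulr_gt0 ?expR_gt0 //; lra.
(* This is (e / D)^(1 / kap), so that D |x|^kap < e for |x| < r2. *)
pose r2 := expR (ln (e / D) / kap).
exists (Num.min (Num.min 1 r2) (Num.min r r1)).
  by rewrite !lt_min ltr01 r0 r10 expR_gt0.
move=> x; rewrite !lt_min => /andP[/andP[x1 xr2] /andP[xr xr1]].
rewrite G0 subr0 ger0_norm; last by rewrite mulr_ge0 ?cmod_ge0 ?expR_ge0.
have [->|x0] := eqVneq x 0; first by rewrite addr0 G0.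
have cx : 0 < cmod x by rewrite cmod_gt0.
have lx : ln (cmod x) < 0 by rewrite ln_lt0 // cx.
rewrite /G WV addrAC subrr add0r.
have fx : cmod (f (zeta + x)) <= C * expR (n%:R * ln (cmod x)).
  apply: le_trans (hC x (ltW xr)) _; apply: ler_wpM2l => //.
  rewrite mulrC expRM_natr lnK ?posrE //.
  by rewrite ler_wiXn2l // ltW.
apply: (@le_lt_trans _ _ (C * expR (n%:R * ln (cmod x)) *
   expR (- (n%:R * (1 - kap) * ln (cmod x)) + (1 - V zeta)))).
  apply: ler_pM; rewrite ?cmod_ge0 ?expR_ge0 // ler_expR.
  by have := hV x xr1; rewrite ltr_norml => /andP[]; lra.
rewrite -mulrA -expRD.
have -> : n%:R * ln (cmod x) + (- (n%:R * (1 - kap) * ln (cmod x)) + (1 - V zeta)) =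
   n%:R * (kap * ln (cmod x)) + (1 - V zeta) by ring.
apply: (@le_lt_trans _ _ (C * expR (kap * ln (cmod x) + (1 - V zeta)))).
  rewrite ler_wpM2l // ler_expR lerD2r.
  have : (1 : R) <= n%:R by rewrite ler1n.
  have : kap * ln (cmod x) < 0 by rewrite pmulr_rlt0.
  nra.
rewrite expRD mulrCA.
have : expR (kap * ln (cmod x)) < e / D.
  rewrite -[e / D]lnK ?posrE ?divr_gt0 // ltr_expR.
  rewrite mulrC -ltr_pdivlMr // -ltr_expR lnK ?posrE //.
rewrite ltr_pdivlMr // => h; apply: le_lt_trans h.
rewrite ler_wpM2l ?expR_ge0 // /D ler_wpM2r ?expR_ge0 //; lra.
Qed.

Lemma jensen_bound_kappa :
  0 <= \sum_(zeta <- Z) ((1 - kap) * ln (cmod zeta) + Psi zeta 0) + Phi 0 + kap.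
Proof.
have Gc z : 0 <= g z -> ccont G z.
  move=> /g1 z1; have [hz|hz] := boolP (z \in Z); first exact: G_near_zero.
  apply: ccontM; first exact/ccont_cmod/analytic_taylor2.
  apply: (@ccont_comp _ (fun t => expR (- t)) W).
    by apply: ccontW; case: (W0R z1 hz).
  apply: continuous_comp; first exact: opp_continuous.
  exact: continuous_expR.
have Gb z : g z = 0 -> G z <= 1.
  move=> gz; have z1 : cmod z < 1 by apply: g1; rewrite gz.
  rewrite /G; have [->|nz] := eqVneq (f z) 0; first by rewrite cmod0 mul0r.
  have cf : 0 < cmod (f z) by rewrite cmod_gt0.
  rewrite -[cmod _]lnK ?posrE // -expRD -[X in _ <= X]expR0 ler_expR subr_le0.
  apply: le_trans (Phib gz nz) _; rewrite /W /W0 [X in X + _]addrC -addrA lerDl.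
  apply: addr_ge0.
    rewrite big_seq; apply: sumr_ge0 => zeta hz.
    have nzz : z != zeta by apply: contraNneq nz => ->; rewrite Zf0.
    have hb := ln_blaschke_le0 (ltW (Z1 hz)) z1 nzz.
    by have := Psib hz gz; have := mulr_ge0_le0 (ltW kap0) hb; rewrite mulrBl mul1r; lra.
  rewrite mulr_ge0 ?(ltW kap0) // subr_ge0 exprn_ile1 ?cmod_ge0 //; exact: ltW.
have Gi z : 0 < g z -> 1 < G z ->
    ~ exists2 r : R, 0 < r & forall h, cmod h < r -> G (z + h) <= G z.
  move=> gz Gz [r r0 hr].
  have z1 : cmod z < 1 by apply: g1; exact: ltW.
  have fz : f z != 0.
    by apply: contraTneq Gz => fz; rewrite /G fz cmod0 mul0r ltr10.
  have zZ : z \notin Z by apply: contraNN fz => /Zf0 ->.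
  have ft := analytic_taylor2 fa z1.
  have [C [r1 r10 hC]] := dharmD (dharm_ln ft fz) (dharmZ (-1) (proj1 (W0R z1 zZ))).
  have cf : 0 < cmod (f z) by rewrite cmod_gt0.
  have /ccontP/(_ _ cf)[r2 r20 hf] := ccont_cmod ft.
  have [t t0 []] : exists2 t : R, 0 < t & [/\ t < r, t < r1, t < r2 & C * t < 4 * kap].
    have C1 : 0 < `|C| + 1 by have := normr_ge0 C; lra.
    have k4 : 0 < 4 * kap / (`|C| + 1) by rewrite divr_gt0 // mulr_gt0.
    exists (Num.min (Num.min r r1) (Num.min r2 (4 * kap / (`|C| + 1))) / 2).
      by rewrite divr_gt0 // !lt_min r0 r10 r20.
    set m := Num.min _ _.
    have m0 : 0 < m by rewrite !lt_min r0 r10 r20.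
    have hm : m / 2 < m by lra.
    move: (hm); rewrite {2}/m !lt_min => /andP[/andP[-> ->] /andP[-> h]]; split => //.
    move: h; rewrite ltr_pdivlMr // => h.
    have t0 : 0 <= m / 2 by lra.
    by have := ler_wpM2r t0 (ler_norm C); move: h; rewrite mulrDr; lra.
  move=> tr tr1 tr2 tC.
  have := hC t t0 tr1; set V := fun x => _.
  (* Up to a constant, ln G is V + kap |z|^2. Its maximality at z, summed over the four points,
     gives dlap V <= -4 kap t^2, against |dlap V| <= C t^3 with C t < 4 kap. *)
  have Vle u : cmod u = 1 -> V (z + u * t%:C) + kap * cmod (z + u * t%:C) ^+ 2 <=
      V z + kap * cmod z ^+ 2.
    move=> u1; have cu : cmod (u * t%:C) = t by rewrite cmodM u1 mul1r cmodR gtr0_norm.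
    have := hr (u * t%:C); rewrite cu => /(_ tr).
    have := hf (u * t%:C); rewrite cu => /(_ tr2).
    rewrite ltr_norml => /andP[h _].
    have cf' : 0 < cmod (f (z + u * t%:C)) by lra.
    rewrite /G -{1}[cmod (f _)]lnK ?posrE // -[cmod (f z)]lnK ?posrE // -!expRD ler_expR.
    rewrite /W /V; lra.
  have := dlap_sqr_cmod z t; rewrite !dlapE => hq.
  have h1 := Vle _ (@cmod1 R); have h2 := Vle _ (@cmodi R).
  have h3 := Vle (-1); rewrite cmodN cmod1 in h3; have {}h3 := h3 erefl.
  have h4 := Vle (- 'i%C); rewrite cmodN cmodi in h4; have {}h4 := h4 erefl.
  rewrite ler_norml => /andP[h5 _].
  have : 4 * kap * t ^+ 2 <= C * t * t ^+ 2.
    rewrite (_ : C * t * t ^+ 2 = C * t ^+ 3); last by ring.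
    have : kap * (4 * t ^+ 2) = kap * (4 * t ^+ 2) by [].
    rewrite -{1}hq; lra.
  by rewrite ler_pM2r ?exprn_gt0 // leNgt tC.
have := max_principle gc (fun z h => ltW (g1 h)) Gc Gb Gi g0.
rewrite /G f0 mul1r -[X in _ <= X]expR0 ler_expR oppr_le0 /W /W0 cmod0 expr0n /= subr0 mulr1.
congr (_ <= _ + _ + _); apply: eq_bigr => zeta _; congr (_ * _ + _).
by rewrite /ln_blaschke mulr0 subr0 cmod1 ln1 subr0 sub0r cmodN.
Qed.

End Kappa.

(** For each kap the preceding bound has the error kap (L + 1), where L is the sum of the -ln
    |zeta|; kap is chosen to make it equal to an arbitrary e. *)
Lemma jensen_bound : \sum_(zeta <- Z) (- ln (cmod zeta) - Psi zeta 0) <= Phi 0.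
Proof.
have L0 : 0 <= \sum_(zeta <- Z) - ln (cmod zeta).
  rewrite big_seq; apply: sumr_ge0 => zeta hz; rewrite oppr_ge0 ln_le0 //.
  exact: ltW (Z1 hz).
set L := \sum_(_ <- _) _ in L0.
apply/ler_addgt0Pr => e e0.
pose k := e / (1 + L).
have L1 : 0 < 1 + L by lra.
have k0 : 0 < k by rewrite divr_gt0.
have kL : k * (1 + L) = e by rewrite divfK // lt0r_neq0.
have := jensen_bound_kappa k0.
have -> : \sum_(zeta <- Z) ((1 - k) * ln (cmod zeta) + Psi zeta 0) =
  k * L - \sum_(zeta <- Z) (- ln (cmod zeta) - Psi zeta 0).
  rewrite /L big_distrr /= -sumrB; apply: eq_bigr => zeta _; ring.
lra.
Qed.

End JensenBound.
End MaximumPrinciple.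

(** * Distance to a set, in particular to a subset of the circle *)

Section Distance.
Context {R : realType}.
Implicit Types (x y z w zeta : R[i]) (A : set R[i]).

Lemma cdist_lb z A w : A w -> cdist z A <= cmod (z - w).
Proof.
move=> Aw; apply: ge_inf; last by exists w.
by exists 0 => _ [v _ <-]; exact: cmod_ge0.
Qed.

Lemma cdist_adherent z A (e : R) : A !=set0 -> 0 < e ->
  exists2 w, A w & cmod (z - w) < cdist z A + e.
Proof.
move=> [w0 Aw0] e0.
have hi : has_inf [set cmod (z - w) | w in A].
  split; first by exists (cmod (z - w0)), w0.
  by exists 0 => _ [v _ <-]; exact: cmod_ge0.
by have [_ [w Aw <-] h] := inf_adherent e0 hi; exists w.
Qed.

Lemma le_cdist z A (a : R) : A !=set0 -> (forall w, A w -> a <= cmod (z - w)) ->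
  a <= cdist z A.
Proof.
move=> [w0 Aw0] h; apply: lb_le_inf; first by exists (cmod (z - w0)), w0.
by move=> _ [w Aw <-]; exact: h.
Qed.

Lemma cdist_lip z w A : A !=set0 -> `|cdist z A - cdist w A| <= cmod (z - w).
Proof.
move=> A0; have h u v : cdist u A - cmod (u - v) <= cdist v A.
  apply: le_cdist => // y Ay; have := cdist_lb u Ay; have := cmod_triangle u v y; lra.
by rewrite ler_distl; have := h z w; have := h w z; rewrite (cmodB w z); lra.
Qed.

Lemma ccont_cdist z A : A !=set0 -> ccont (fun x => cdist x A) z.
Proof.
move=> A0; apply: (@lip_ccont _ _ _ 1 1) => // x _; rewrite mul1r.
by apply: le_trans (cdist_lip _ _ A0) _; rewrite addrC addKr.
Qed.

Lemma cdist_set1 z w : cdist z [set w] = cmod (z - w).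
Proof. by rewrite /cdist image_set1 inf1. Qed.

Lemma cdist_seq z (s : seq R[i]) : s != [::] ->
  exists2 w, w \in s & cdist z [set v | v \in s] = cmod (z - w).
Proof.
move=> s0.
have [w ws wmin] : exists2 w, w \in s & forall v, v \in s -> cmod (z - w) <= cmod (z - v).
  elim: s s0 => // v s IH _; have [->|/IH[w ws wmin]] := eqVneq s [::].
    by exists v; rewrite ?inE // => u; rewrite inE => /eqP ->.
  have [h|h] := leP (cmod (z - w)) (cmod (z - v)).
    exists w; first by rewrite inE ws orbT.
    by move=> u; rewrite inE => /orP[/eqP ->//|]; exact: wmin.
  exists v; first by rewrite mem_head.
  move=> u; rewrite inE => /orP[/eqP ->//|/wmin]; exact/le_trans/ltW.
exists w => //; apply/eqP; rewrite eq_le cdist_lb //=; apply: le_cdist => //.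
by exists w.
Qed.

Section OnCircle.
Variable F : set R[i].
Hypotheses (F0 : F !=set0) (FT : F `<=` @on_circle R).

Lemma cdist_ge_1B z : 1 - cmod z <= cdist z F.
Proof.
apply: le_cdist => // w /FT wT; have := ler_cmod_dist w z; rewrite wT cmodB.
exact/le_trans/ler_norm.
Qed.

Lemma cdist_lt2 z : cmod z < 1 -> cdist z F < 2.
Proof.
case: F0 => w Fw z1; apply: le_lt_trans (cdist_lb z Fw) _.
by apply: le_lt_trans (ler_cmodB _ _) _; rewrite (FT Fw); lra.
Qed.

Lemma cdist0 : cdist 0 F = 1.
Proof.
apply/eqP; rewrite eq_le; apply/andP; split; last first.
  by have := cdist_ge_1B 0; rewrite cmod0 subr0.
by case: F0 => w Fw; apply: le_trans (cdist_lb 0 Fw) _; rewrite sub0r cmodN (FT Fw).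
Qed.

End OnCircle.
End Distance.

(** * Positive harmonic kernels *)

Section Kernels.
Context {R : realType}.
Implicit Types (z w zeta : R[i]) (s : R).

(* For s > 0 and |b| = 1, s * kern s b is a positive harmonic function which is
   of order 1 within s of the boundary point 1 / b and about s at 0. *)
Definition kern s (b z : R[i]) : R := Re (1 + s%:C - b * z)^-1.

Section KernelBounds.
Variables (s : R) (b : R[i]).
Hypotheses (s0 : 0 <= s) (b1 : cmod b <= 1).

Let ReE z : Re (1 + s%:C - b * z) = 1 + s - Re (b * z).
Proof. by rewrite ReB ReD. Qed.

Lemma kern_den_gt0 z : cmod z < 1 -> 0 < cmod (1 + s%:C - b * z).
Proof.
move=> z1; apply: lt_le_trans (ler_Re_cmod _); rewrite ReE.
apply: lt_le_trans (ler_norm _).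
have : cmod (b * z) < 1 by rewrite cmodM; apply: le_lt_trans z1; rewrite ler_piMl ?cmod_ge0.
by have := s0; have := ler_Re_cmod (b * z) => /(le_trans (ler_norm _)); lra.
Qed.

Lemma kern_regular z : cmod z < 1 -> regular_at (kern s b) z.
Proof.
move=> z1; apply: regular_Re.
have := @taylor2_inv_affine _ (1 + s%:C) (- b) z; rewrite mulNr -cmod_gt0.
move=> /(_ (kern_den_gt0 z1)); congr (taylor2 _ _).
by apply/funext => x; rewrite mulNr.
Qed.

(** Here Re(1 / u) = Re u / |u|^2 with u = 1 + s - b z. For b = conj(zeta) with |zeta| < 1, even s =
    0 gives (1 - |zeta|) / |1 - conj(zeta) z|^2, which is the profile of the Blaschke deficit per
    unit of 1 - |z|. *)
Lemma kern_lb z : cmod z < 1 ->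
  (s + (1 - cmod b)) / (s + cmod (1 - b * z)) ^+ 2 <= kern s b z.
Proof.
move=> z1; rewrite /kern Re_inv.
have bz : cmod (b * z) <= cmod b.
  by rewrite cmodM ler_piMr ?cmod_ge0 // ltW.
have u0 := kern_den_gt0 z1.
have hu : cmod (1 + s%:C - b * z) <= s + cmod (1 - b * z).
  rewrite (_ : _ - _ = s%:C + (1 - b * z)); last by ring.
  by apply: le_trans (ler_cmodD _ _) _; rewrite cmodR ger0_norm.
have hr : s + (1 - cmod b) <= Re (1 + s%:C - b * z).
  by rewrite ReE; have := ler_Re_cmod (b * z) => /(le_trans (ler_norm _)); lra.
have h0 : 0 <= s + (1 - cmod b) by have := s0; have := b1; lra.
apply: ler_pM => //.
  by rewrite invr_ge0 exprn_ge0 // addr_ge0 // cmod_ge0.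
by rewrite lef_pV2 ?posrE ?exprn_gt0 ?(lt_le_trans u0 hu) // lerXn2r ?nnegrE ?(ltW u0) // (le_trans (ltW u0)).
Qed.

Lemma kern_ge0 z : cmod z < 1 -> 0 <= kern s b z.
Proof.
move=> z1; apply: le_trans (kern_lb z1); apply: divr_ge0; first by have := s0; have := b1; lra.
by rewrite exprn_ge0 // addr_ge0 // cmod_ge0.
Qed.

Lemma kern0_le1 : kern s b 0 <= 1.
Proof.
rewrite /kern; set u := 1 + s%:C - b * 0.
have u1 : 1 <= cmod u.
  apply: le_trans (ler_Re_cmod _); apply: le_trans (ler_norm _).
  by rewrite ReE mulr0 /=; have := s0; lra.
rewrite Re_inv ler_pdivrMr ?exprn_gt0 ?mul1r //; last lra.
apply: le_trans (ler_norm _) _; apply: le_trans (ler_Re_cmod u) _.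
by rewrite expr2 ler_peMl ?cmod_ge0.
Qed.

End KernelBounds.

Lemma on_circle_conj_dist zeta z : on_circle zeta -> cmod (1 - zeta^* * z) = cmod (z - zeta).
Proof.
move=> h; apply/eqP; rewrite -(@eqrXn2 _ 2%N) ?cmod_ge0 // blaschke_id.
by rewrite h expr1n subrr mulr0 addr0.
Qed.


Lemma sum_geometric_le (q : R) n : 0 <= q -> q < 1 -> \sum_(j < n) q ^+ j <= (1 - q)^-1.
Proof.
move=> q0 q1; rewrite -[leRHS]mul1r ler_pdivlMr; last lra.
have := subrX1 q n; rewrite mulrC => h.
by have := exprn_ge0 n q0; move: h; set S := \sum_(_ < _) _; nra.
Qed.

End Kernels.

(** * A harmonic majorant of dist(z, F)^(-q) built from nets of F *)

Section Majorant.
Context {R : realType}.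
Variables (F : set R[i]) (C alpha q eta : R).
Hypotheses (F0 : F !=set0) (FT : F `<=` @on_circle R).
Hypotheses (q0 : 0 <= q) (eta0 : 0 < eta) (etaq : 0 <= alpha - q + eta).
Hypothesis nets : forall s : R, 0 < s -> s <= 2 -> exists2 S : seq R[i],
  (forall zeta, zeta \in S -> on_circle zeta) /\
  (forall w, F w -> exists2 zeta, zeta \in S & cmod (w - zeta) <= s) &
  (size S)%:R * s <= C * s `^ alpha.

(** At the scale sc = 2^j d, kernels of width sc sit on a net of F; with weights of order sc^(1 - q)
    they dominate dist(z, F)^(-q) where dist(z, F) lies between sc and 2 sc. At 0 they contribute at
    most 25 C sc^(alpha - q) = 25 C sc^(alpha - q + eta) sc^(-eta): the first power is bounded since
    sc <= 2, and the powers sc^(-eta) form a geometric series led by d^(-eta). *)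
Lemma majorant_exists (d : R) : 0 < d -> exists Phi : R[i] -> R,
  [/\ forall z, cmod z < 1 -> regular_at Phi z,
      forall z, cmod z < 1 -> 0 <= Phi z,
      forall z, cmod z < 1 -> d <= cdist z F -> cdist z F `^ (- q) <= Phi z &
      Phi 0 <= 25 * C * 2 `^ (alpha - q + eta) / (1 - 2 `^ (- eta)) * d `^ (- eta)].
Proof.
move=> d0.
pose sc j : R := 2 ^+ j * d.
have sc0 j : 0 < sc j by rewrite mulr_gt0 // exprn_gt0.
have [J HJ] : exists J : nat, 2 < sc J.
  exists (Num.Def.archi_bound (2 / d)); rewrite -ltr_pdivrMr //.
  exact: upper_nthrootP.
have /choice[S HS] : forall j : nat, exists S : seq R[i], sc j <= 2 ->
  [/\ forall zeta, zeta \in S -> on_circle zeta,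
   forall w, F w -> exists2 zeta, zeta \in S & cmod (w - zeta) <= sc j &
   (size S)%:R * sc j <= C * sc j `^ alpha].
  move=> j; have [h|h] := leP (sc j) 2; last by exists [::].
  by have [S [S1 S2] S3] := nets (sc0 j) h; exists S => _; split.
(* 25 = 5^2: a point z with dist(z, F) < 2 sc has a net point within 4 sc (2 sc for the distance, sc
   for an almost nearest point of F, sc for the net), so sc times the kernel there is at least sc^2
   / (5 sc)^2. *)
pose T j z := 25 * sc j `^ (- q) * sc j * \sum_(zeta <- S j) kern (sc j) zeta^* z.
pose Phi z := \sum_(j < J | sc j <= 2) T j z.
have kS j zeta : sc j <= 2 -> zeta \in S j -> cmod zeta^* <= 1.
  by move=> /HS[h _ _] /h; rewrite cmod_conj => ->.
have kge j z : sc j <= 2 -> cmod z < 1 -> 0 <= \sum_(zeta <- S j) kern (sc j) zeta^* z.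
  move=> hj z1; rewrite big_seq; apply: sumr_ge0 => zeta hz.
  by apply: kern_ge0 => //; [exact: ltW | exact: kS hz].
have Tge j z : sc j <= 2 -> cmod z < 1 -> 0 <= T j z.
  move=> hj z1; rewrite mulr_ge0 ?kge // mulr_ge0 ?(ltW (sc0 _)) // mulr_ge0 ?powR_ge0 //.
exists Phi; split.
- move=> z z1.
  have -> : Phi = fun x => \sum_(j < J) \sum_(zeta <- S j) (if (sc j <= 2) && (zeta \in S j) then
     25 * sc j `^ (- q) * sc j * kern (sc j) zeta^* x else 0).
    apply/funext => x; rewrite /Phi big_mkcond; apply: eq_bigr => j _.
    case: ifPn => hj; last by rewrite big1.
    by rewrite /T big_distrr; apply: eq_big_seq => zeta ->.
  apply: regular_sum => j; apply: regular_sum => zeta.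
  case: (boolP ((sc j <= 2) && (zeta \in S j))) => [/andP[hj hz]|_]; last first.
    by split; [exact: dharm_cst | exact: ccont_cst].
  by apply: regularZ; apply: kern_regular => //; [exact: ltW | exact: kS hz].
- by move=> z z1; apply: sumr_ge0 => j hj; exact: Tge.
- move=> z z1 dz; set x := cdist z F in dz *.
  have x2 : x < 2 := cdist_lt2 F0 FT z1.
  have x0 : 0 < x by exact: lt_le_trans dz.
  have [j jJ /andP[jx xj]] : exists2 j, (j < J)%N & sc j <= x < sc j.+1.
    have exj : exists k, x < sc k by exists J; lra.
    have := ex_minnP exj; case=> -[|m]; first by rewrite /sc expr0 mul1r ltNge dz.
    move=> hm hmin; exists m; last by rewrite hm andbT leNgt; apply/negP => /hmin; rewrite ltnn.
    by apply: hmin; lra.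
  have hj : sc j <= 2 by apply: ltW; apply: le_lt_trans jx x2.
  have [S1 S2 S3] := HS j hj.
  have [w Fw hw] := cdist_adherent z F0 (sc0 j).
  have [zeta hz wz] := S2 w Fw.
  have dzz : cmod (z - zeta) <= 4 * sc j.
    have := cmod_triangle z w zeta; move: xj; rewrite /sc exprS -mulrA -/(sc j) -/x.
    by move: hw; rewrite -/x; lra.
  apply: (@le_trans _ _ (T j z)); last first.
    rewrite /Phi (bigD1 (Ordinal jJ)) //= lerDl; apply: sumr_ge0 => k /andP[hk _].
    exact: Tge.
  have k1 : 1 / (25 * sc j) <= \sum_(zeta <- S j) kern (sc j) zeta^* z.
    rewrite (perm_big _ (perm_to_rem hz)) big_cons.
    have rest : 0 <= \sum_(zeta0 <- rem zeta (S j)) kern (sc j) zeta0^* z.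
      rewrite big_seq; apply: sumr_ge0 => xi /mem_rem hxi.
      by apply: kern_ge0 => //; [exact: ltW | exact: kS hxi].
    have h := kern_lb (ltW (sc0 j)) (kS _ _ hj hz) z1.
    rewrite cmod_conj (S1 _ hz) subrr addr0 on_circle_conj_dist in h; last exact: S1.
    apply: le_trans (lerD h rest); rewrite addr0 ler_pdivlMr; last first.
      by rewrite exprn_gt0 // ltr_wpDr // cmod_ge0.
    rewrite mulrAC ler_pdivrMr ?mulr_gt0 //.
    have : (sc j + cmod (z - zeta)) ^+ 2 <= (5 * sc j) ^+ 2.
      rewrite lerXn2r ?nnegrE ?addr_ge0 ?cmod_ge0 ?mulr_ge0 ?(ltW (sc0 _)) //; lra.
    lra.
  have xq : x `^ (- q) <= sc j `^ (- q).
    rewrite !powRN lef_pV2 ?posrE ?powR_gt0 //.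
    by apply: ge0_ler_powR; rewrite ?nnegrE // ltW.
  apply: (le_trans xq).
  have := ler_wpM2l (powR_ge0 (sc j) (- q)) (ler_wpM2l (ltW (sc0 j)) (ler_wpM2l (ler0n R 25) k1)).
  have -> : sc j * (25 * (1 / (25 * sc j))) = 1 by field; rewrite lt0r_neq0.
  rewrite mulr1 => /le_trans; apply; rewrite /T le_eqVlt; apply/orP; left; apply/eqP; ring.
have C0 : 0 <= C.
  have two : 0 < 2 :> R by [].
  have [S0 _ h] := nets two (lexx 2).
  by rewrite -(pmulr_lge0 _ (powR_gt0 alpha two)); apply: le_trans h; rewrite mulr_ge0.
pose B := 25 * C * 2 `^ (alpha - q + eta) * d `^ (- eta).
have t0 : 0 <= 2 `^ (- eta) :> R by exact: powR_ge0.
have t1 : 2 `^ (- eta) < 1 :> R.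
  have p1 : 1 `^ eta = 1 :> R by rewrite powR1.
  rewrite powRN invf_lt1 ?powR_gt0 // -[ltLHS]p1.
  by apply: gt0_ltr_powR; rewrite ?nnegrE ?ltr1n ?ler0n ?ler01.
have Tj j : sc j <= 2 -> T j 0 <= B * (2 `^ (- eta)) ^+ j.
  move=> hj; have [S1 S2 S3] := HS j hj.
  have : T j 0 <= 25 * sc j `^ (- q) * (C * sc j `^ alpha).
    rewrite /T -mulrA ler_wpM2l ?mulr_ge0 ?powR_ge0 //.
    apply: (le_trans _ S3); rewrite [leLHS]mulrC ler_pM2r //.
    rewrite -sum1_size natr_sum big_seq [leRHS]big_seq; apply: ler_sum => zeta hz.
    by apply: kern0_le1; exact: ltW.
  move=> /le_trans; apply.
  have -> : 25 * sc j `^ (- q) * (C * sc j `^ alpha) =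
     25 * C * sc j `^ (alpha - q + eta) * sc j `^ (- eta).
    have E : sc j `^ alpha * sc j `^ (- q) = sc j `^ (alpha - q + eta) * sc j `^ (- eta).
      by rewrite -!powRD ?(lt0r_neq0 (sc0 j)) ?implybT // addrK.
    by transitivity (25 * C * (sc j `^ alpha * sc j `^ (- q))); [ring|rewrite E; ring].
  have -> : B * 2 `^ (- eta) ^+ j = 25 * C * 2 `^ (alpha - q + eta) * sc j `^ (- eta).
    rewrite /B /sc powRM ?exprn_ge0 ?(ltW d0) // -!powR_mulrn ?powR_ge0 //.
    by rewrite -!powRrM [j%:R * _]mulrC; ring.
  rewrite ler_pM2r ?powR_gt0 // ler_wpM2l ?mulr_ge0 //.
  by apply: ge0_ler_powR; rewrite ?nnegrE // ltW.
apply: (@le_trans _ _ (\sum_(j < J | sc j <= 2) B * (2 `^ (- eta)) ^+ j)).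
  by apply: ler_sum => j; exact: Tj.
have B0 : 0 <= B by rewrite !mulr_ge0 ?powR_ge0.
rewrite -big_distrr /=.
have : \sum_(j < J | sc j <= 2) (2 `^ (- eta)) ^+ j <= (1 - 2 `^ (- eta))^-1.
  apply: le_trans (sum_geometric_le J t0 t1).
  by rewrite big_mkcond; apply: ler_sum => j _; case: ifP => // _; exact: exprn_ge0.
by move=> /(ler_wpM2l B0) /le_trans; apply; rewrite /B le_eqVlt; apply/orP; left; apply/eqP; ring.
Qed.

End Majorant.

(** * Packings and nets of F, controlled by the measure of its neighbourhoods *)

Section Packing.
Context {R : realType}.
Implicit Types (z w zeta xi : R[i]) (F : set R[i]) (s t : R).

Lemma on_circle_arg z : on_circle z ->
  exists2 a : R, 0 <= a < 2 * pi & z = cos a +i* sin a.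
Proof.
case: z => x y hz; have : cmod (x +i* y) ^+ 2 = 1 by rewrite hz expr1n.
rewrite sqr_cmod /= => hxy.
have x2 : x ^+ 2 <= 1 by have := sqr_ge0 y; lra.
have x1 : -1 <= x <= 1 by rewrite -ler_norml -(@expr_le1 _ 2) ?normr_ge0 // real_normK ?num_real.
have [/andP[a0 api] ca] := acos_def x1; have sa := sin_acos x1.
have pi0 := pi_gt0 R.
rewrite (_ : 1 - x ^+ 2 = y ^+ 2) in sa; last by lra.
rewrite sqrtr_sqr in sa.
have [y0|y0] := leP 0 y.
  exists (acos x); first by rewrite a0 /=; lra.
  by rewrite ca sa ger0_norm.
exists (2 * pi - acos x).
  have a0' : acos x != 0.
    apply/eqP => a00; move: sa; rewrite a00 sin0 => /esym/eqP; rewrite normr_eq0.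
    by rewrite lt_eqF.
  have : 0 < acos x by rewrite lt_def a0' a0.
  by move=> ?; apply/andP; split; lra.
have -> : 2 * pi - acos x = - acos x + pi *+ 2 by rewrite -mulr_natl; ring.
by rewrite (cosD _ (pi *+ 2)) (sinD _ (pi *+ 2)) cos2pi sin2pi !mulr1 !mulr0 subr0 addr0 cosN sinN ca sa ltr0_norm ?opprK.
Qed.

Lemma circle_lip (a b : R) :
  cmod ((cos a +i* sin a) - (cos b +i* sin b)) <= 2 * `|a - b|.
Proof.
have lip (h dh : R -> R) : (forall x : R, is_derive x (1 : R) h (dh x)) -> (forall x, `|dh x| <= 1) ->
    forall x y, `|h x - h y| <= `|x - y|.
  move=> hd d1 x y; wlog xy : x y / x <= y.
    move=> W; have [|/ltW] := leP x y; first exact: W.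
    by rewrite [`|h x - h y|]distrC [`|x - y|]distrC; exact: W.
  have hc : {within `[x, y], continuous h}.
    apply: derivable_within_continuous => u _; exact: ex_derive.
  have [c _ E] := MVT_segment xy (fun u _ => hd u) hc.
  by rewrite distrC E normrM [`|x - y|]distrC ler_piMl ?normr_ge0.
have h1 : `|cos a - cos b| <= `|a - b|.
  apply: (lip cos (fun x => - sin x)) => x; rewrite normrN; exact: sin_max.
have h2 : `|sin a - sin b| <= `|a - b|.
  apply: (lip sin cos) => x; exact: cos_max.
have -> : (cos a +i* sin a) - (cos b +i* sin b) =
  (cos a - cos b)%:C + 'i%C * (sin a - sin b)%:C by exact: complexE.
by apply: le_trans (ler_cmodD _ _) _; rewrite cmodM cmodi !cmodR; lra.
Qed.

Definition separated s (S : seq R[i]) :=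
  uniq S /\ forall z w, z \in S -> w \in S -> z != w -> s <= cmod (z - w).

(** Each point of S gets an interval of length s / 4 at its argument. By [circle_lip] its image
    stays within s / 2 of the point, hence inside the neighbourhood of F, and separation makes the
    intervals disjoint. *)
Lemma packing_measure F s (S : seq R[i]) : F `<=` @on_circle R ->
  0 < s -> s <= 4 -> separated s S -> (forall z, z \in S -> F z) ->
  (((size S)%:R * (s / 4))%:E <= nbhd_arc_measure F s)%E.
Proof.
move=> FT s0 s4 [uS sepS] SF.
have /choice[th Hth] : forall z, exists a : R, F z -> 0 <= a < 2 * pi /\ z = cos a +i* sin a.
  move=> z; have [Fz|nF] := pselect (F z); last by exists 0.
  by have [a h1 h2] := on_circle_arg (FT _ Fz); exists a.
(* The interval extends to the right of arguments up to pi and to the left of the others, so that it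
   never leaves [0, 2 pi): s / 4 <= 1 and pi >= 2. *)
pose I z : interval R := if th z <= pi then `[th z, th z + s / 4[%O else `]th z - s / 4, th z]%O.
have pi2 := pi_ge2 R.
have Inear z t : t \in I z -> `|t - th z| < s / 4.
  by rewrite /I; case: ifP => _; rewrite in_itv /= ltr_distl => /andP[h1 h2]; apply/andP; split; lra.
have Idist z t : F z -> t \in I z -> cmod ((cos t +i* sin t) - z) < s / 2.
  move=> Fz /Inear h; have [_ {1}->] := Hth z Fz.
  by apply: le_lt_trans (circle_lip _ _) _; lra.
have Iarc z t : F z -> t \in I z -> 0 <= t < 2 * pi.
  move=> Fz; have [/andP[h1 h2] _] := Hth z Fz.
  by rewrite /I; case: (leP (th z) pi) => h; rewrite in_itv /= => /andP[h3 h4]; apply/andP; split; lra.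
have muI z : lebesgue_measure ([set` I z] : set R) = (s / 4)%:E.
  rewrite /I; case: ifP => _; rewrite lebesgue_measure_itv /= lte_fin ifT ?ltrBlDr ?ltrDl ?divr_gt0 //;
    congr (_%:E); ring.
pose U := \big[setU/set0]_(i < size S) ([set` I (nth 0 S i)] : set R).
have muU : lebesgue_measure U = ((size S)%:R * (s / 4))%:E.
  rewrite /U measure_bigsetU_ord.
  - rewrite (eq_bigr (fun=> (s / 4)%:E)) => [|i _]; last exact: muI.
    by rewrite sumEFin sumr_const card_ord mulr_natl.
  - by move=> i; exact: measurable_itv.
  - move=> i j _ _ [t [/= ti tj]]; apply/val_inj/eqP.
    rewrite -(nth_uniq 0 (ltn_ord i) (ltn_ord j) uS); apply/negPn/negP => ne.
    have Si := mem_nth 0 (ltn_ord i); have Sj := mem_nth 0 (ltn_ord j).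
    have := sepS _ _ Si Sj ne.
    have := Idist _ _ (SF _ Si) ti; have := Idist _ _ (SF _ Sj) tj.
    have := cmod_triangle (nth 0 S i) (cos t +i* sin t) (nth 0 S j).
    rewrite (cmodB (nth 0 S i)  (cos t +i* sin t)); lra.
have US t : U t -> exists2 i, (i < size S)%N & t \in I (nth 0 S i).
  by rewrite /U -(bigcup_mkord _ (fun i => [set` I (nth 0 S i)])) => -[i /= iS ti]; exists i.
rewrite -muU; apply: le_mu_ext => t /US[i iS ti].
have Si := mem_nth 0 iS; split; first exact: (Iarc _ _ (SF _ Si)).
apply: le_lt_trans (cdist_lb _ (SF _ Si)) _.
by apply: lt_le_trans (Idist _ _ (SF _ Si) ti) _; lra.
Qed.

Lemma nbhd_arc_measure_le F s : (nbhd_arc_measure F s <= (2 * pi)%:E)%E.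
Proof.
have pi0 := pi_gt0 R.
have -> : (2 * pi)%:E = lebesgue_measure ([set` `[0, 2 * pi[%O] : set R).
  rewrite lebesgue_measure_itv /= lte_fin ifT; last by lra.
  by rewrite -EFinB subr0.
by apply: le_mu_ext => t [/= h _]; rewrite in_itv.
Qed.

Lemma bigO_at0_0 F : bigO_at0 F 0.
Proof.
exists (2 * pi), 1 => // x _ _; rewrite powRr0 mulr1; exact: nbhd_arc_measure_le.
Qed.

(* [sup] is 0 on unbounded sets; exponent 0 is then admissible as well. *)
Lemma AC_type_adherent F (e : R) : 0 < e -> exists2 a, bigO_at0 F a & AC_type F - e < a.
Proof.
move=> e0; have [hs|hs] := pselect (has_sup [set a : R | bigO_at0 F a]).
  by have [a h1 h2] := sup_adherent e0 hs; exists a.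
exists 0; first exact: bigO_at0_0.
by rewrite /AC_type sup_out //; lra.
Qed.

Lemma packing_bound F alpha : F `<=` @on_circle R -> bigO_at0 F alpha ->
  exists2 C : R, 0 < C & forall s (S : seq R[i]), 0 < s -> s <= 2 -> separated s S ->
    (forall z, z \in S -> F z) -> (size S)%:R * s <= C * s `^ alpha.
Proof.
move=> FT [C [d d0 H]].
(* A lower bound of s^alpha for d <= s <= 2, whatever the sign of alpha; for these s the trivial
   bound 2 pi of the measure suffices. *)
pose m := Num.min (d `^ alpha) (2 `^ alpha).
have m0 : 0 < m by rewrite lt_min !powR_gt0.
have pi0 := pi_gt0 R.
exists (4 * (`|C| + 2 * pi / m)).
  by rewrite mulr_gt0 // ltr_wpDl // divr_gt0 // mulr_gt0.
move=> s S s0 s2 sep SF.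
have pm := packing_measure FT s0 (le_trans s2 _) sep SF.
have {}pm : (((size S)%:R * (s / 4))%:E <= nbhd_arc_measure F s)%E by apply: pm; lra.
have sa : 0 < s `^ alpha by exact: powR_gt0.
suff : (size S)%:R * (s / 4) <= (`|C| + 2 * pi / m) * s `^ alpha by lra.
have [sd|ds] := ltP s d.
  have := le_trans pm (H s s0 sd); rewrite lee_fin => /le_trans; apply.
  rewrite ler_pM2r //; have := ler_norm C.
  have : 0 <= 2 * pi / m by rewrite divr_ge0 // ?ltW // mulr_gt0.
  lra.
have := le_trans pm (nbhd_arc_measure_le F s); rewrite lee_fin => /le_trans; apply.
have ms : m <= s `^ alpha.
  rewrite ge_min; have [a0|a0] := leP 0 alpha.
    by apply/orP; left; apply: ge0_ler_powR; rewrite ?nnegrE // ltW.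
  apply/orP; right; rewrite -[alpha]opprK [leLHS]powRN [leRHS]powRN lef_pV2 ?posrE ?powR_gt0 //.
  by apply: ge0_ler_powR; rewrite ?nnegrE ?oppr_ge0 // ltW.
have : 2 * pi / m * m <= 2 * pi / m * s `^ alpha.
  by rewrite ler_wpM2l // divr_ge0 ?ltW // mulr_gt0.
rewrite divfK ?lt0r_neq0 // => h; apply: le_trans h _.
by rewrite ler_pM2r // lerDr.
Qed.

(** [packing_bound] limits the size of the separated subsets of F; one of maximal size is a net,
    since a point of F farther than s from it could be added. *)
Lemma net_exists F alpha : F `<=` @on_circle R -> bigO_at0 F alpha ->
  exists2 C : R, 0 < C & forall s, 0 < s -> s <= 2 -> exists2 S : seq R[i],
  (forall zeta, zeta \in S -> on_circle zeta) /\
  (forall w, F w -> exists2 zeta, zeta \in S & cmod (w - zeta) <= s) &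
  (size S)%:R * s <= C * s `^ alpha.
Proof.
move=> FT /(packing_bound FT)[C C0 H]; exists C => // s s0 s2.
pose P n := `[< exists S : seq R[i], [/\ separated s S, forall z, z \in S -> F z & size S = n] >].
have exP : exists n, P n by exists 0%N; apply/asboolP; exists [::].
have bP n : P n -> (n <= Num.truncn (C * s `^ alpha / s))%N.
  move=> /asboolP[S [sep SF <-]]; rewrite truncn_ge_nat; last first.
    by rewrite divr_ge0 ?mulr_ge0 ?powR_ge0 // ltW.
  by rewrite ler_pdivlMr //; exact: H.
case: (ex_maxnP exP bP) => n /asboolP[S [sep SF Sn]] nmax.
exists S; last exact: H.
split=> [z /SF /FT //|w Fw].
apply: contrapT => hw.
have far z : z \in S -> s < cmod (w - z).
  by move=> zS; rewrite ltNge; apply/negP => h; apply: hw; exists z.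
have : P n.+1.
  apply/asboolP; exists (w :: S); split; last by rewrite /= Sn.
    case: sep => uS sepS; split.
      rewrite /= uS andbT; apply/negP => /far; rewrite subrr cmod0; lra.
    move=> u v; rewrite !inE => /orP[/eqP->|uS'] /orP[/eqP->|vS']; first by rewrite eqxx.
    - by move=> _; exact/ltW/far.
    - by move=> _; rewrite cmodB; exact/ltW/far.
    - exact: sepS.
  by move=> z; rewrite inE => /orP[/eqP->|/SF].
by move=> /nmax; rewrite ltnn.
Qed.

End Packing.

(** * Lower bounds for the Blaschke factor and their harmonic correction *)

Section BlaschkeFactor.
Context {R : realType}.
Implicit Types (z zeta : R[i]).

Lemma powR_invl (x a : R) : 0 <= x -> x^-1 `^ a = (x `^ a)^-1.
Proof. by move=> x0; rewrite -powR_inv1 // -powRrM mulN1r powRN. Qed.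

(** The hypothesis yields |b|^2 >= 1 - a, the 4 bounding (1 + |z|) (1 + |zeta|). Then ln (1 - a) >=
    -2 a, and passing from |b|^2 to |b| halves this. *)
Lemma ln_blaschke_ge zeta z (a : R) : cmod zeta < 1 -> cmod z < 1 ->
  4 * (1 - cmod z) * (1 - cmod zeta) <= a * cmod (1 - zeta^* * z) ^+ 2 ->
  a <= 2^-1 -> - a <= ln_blaschke zeta z.
Proof.
move=> h1 h2 h3 a2; have y0 := conj_affine_gt0 (ltW h1) h2.
have E := blaschke_id zeta z.
set y := cmod (1 - _) in y0 E h3 *; set v := cmod (z - zeta) in E *.
have c1 := cmod_ge0 z; have c2 := cmod_ge0 zeta.
have hX : (1 - cmod z ^+ 2) * (1 - cmod zeta ^+ 2) <= a * y ^+ 2.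
  apply: (le_trans _ h3).
  have : (1 - cmod z) * (1 - cmod zeta) * ((1 + cmod z) * (1 + cmod zeta)) <=
    (1 - cmod z) * (1 - cmod zeta) * 4.
    apply: ler_wpM2l; first by rewrite mulr_ge0 // subr_ge0 ltW.
    by have := @ler_pM _ (1 + cmod z) 2 (1 + cmod zeta) 2; move=> /(_ _ _ _ _)/le_trans; apply; lra.
  rewrite (_ : (1 - cmod z ^+ 2) * _ = (1 - cmod z) * (1 - cmod zeta) *
    ((1 + cmod z) * (1 + cmod zeta))); last by ring.
  by move=> h; apply: (le_trans h); lra.
have y2 : 0 < y ^+ 2 by rewrite exprn_gt0.
have v2 : (1 - a) * y ^+ 2 <= v ^+ 2 by rewrite mulrBl mul1r; lra.
have v0 : 0 < v.
  have : 0 < v ^+ 2 by apply: lt_le_trans v2; rewrite mulr_gt0 //; lra.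
  by rewrite exprn_even_gt0 //= lt_def cmod_ge0 andbT => ->.
have u1 : 1 - a <= v ^+ 2 / y ^+ 2 by rewrite ler_pdivlMr.
have a0 : 0 <= a.
  rewrite -(pmulr_lge0 _ y2); apply: le_trans h3; rewrite !mulr_ge0 //; lra.
have : ln (1 - a) <= ln (v ^+ 2 / y ^+ 2) by rewrite ler_ln ?posrE ?divr_gt0 ?exprn_gt0 //; lra.
rewrite ln_div ?posrE ?exprn_gt0 // !lnXn //.
have ea : `|1 - a - 1| = a.
  by rewrite (_ : 1 - a - 1 = - a) ?normrN ?ger0_norm //; ring.
have := @ler_norm_ln R (1 - a); rewrite ea.
by move=> /(_ a2); rewrite ler_norml => /andP[]; rewrite /ln_blaschke -/v -/y; lra.
Qed.

End BlaschkeFactor.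

(** Since gam < 1 and m >= s, (m / s)^gam <= m / s: the height of the domain grows at most linearly
    away from e. *)
Lemma height_le (R : realType) (gam M del s m : R) : gam < 1 -> 0 < M -> 0 < del -> 0 < s -> s <= m ->
  del / (M * s `^ gam) * m `^ gam <= del / M * (m / s).
Proof.
move=> gam1 Mp del0 s0 sm; have m0 : 0 < m by exact: lt_le_trans sm.
have -> : del / (M * s `^ gam) * m `^ gam = del / M * (m / s) `^ gam.
  by rewrite powRM ?invr_ge0 ?(ltW s0) ?(ltW m0) // powR_invl ?(ltW s0) // invfM; ring.
rewrite ler_pM2l ?divr_gt0 //; apply: ler1_powR; last exact: ltW.
by rewrite ler_pdivlMr // mul1r.
Qed.

(* The two alternatives are the two kinds of boundary points of the domain. The
   first kernel term dominates the Blaschke deficit near zeta, [v] far from zeta,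
   and the last term on the part of the boundary close to F. *)
Lemma blaschke_correction (R : realType) (F : set R[i]) (e zeta z : R[i]) (gam M del s d v : R) :
  F !=set0 -> F `<=` @on_circle R -> on_circle e ->
  gam < 1 -> 208 <= M -> 0 < del -> 0 < s -> 0 < d ->
  del <= 2 * s -> del <= 2 * d -> cmod zeta < 1 ->
  del <= 1 - cmod zeta <= 2 * del -> s <= cmod (zeta - e) <= 2 * s ->
  d <= cdist zeta F -> cmod z < 1 -> 0 <= v ->
  (s <= cmod (z - e) -> cmod (z - e) `^ (- (2 - gam)) <= v) ->
  1 - cmod z = del / (M * s `^ gam) * Num.max (cmod (z - e)) s `^ gam \/
    cdist z F = d / M ->
  0 <= ln_blaschke zeta z + (32 * (del / M) * kern 0 zeta^* z +
    (32 * (del ^+ 2 / M) / s `^ gam * v + 72 * (del / M) * kern d zeta^* z)).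
Proof.
move=> F0 FT eT gam1 M0 del0 s0 d0 ds dd zt1 /andP[x1 x2] /andP[x3 x4] x5 z1 ke hv.
set m := Num.max _ s; set t := del / _ => hb; set Psi := 32 * _ * _ + _.
have Mp : 0 < M by lra.
have sg0 : 0 < s `^ gam by exact: powR_gt0.
have dM : 0 < del / M by rewrite divr_gt0.
have ms : s <= m by rewrite /m le_max lexx orbT.
have m0 : 0 < m by exact: lt_le_trans ms.
have tm := @height_le _ gam M del s m gam1 Mp del0 s0 ms; rewrite -/t in tm.
have D0 : 0 < 1 - cmod z by rewrite subr_gt0.
have y0 := conj_affine_gt0 (ltW zt1) z1.
have yz := cmod_blaschke_le (ltW zt1) (ltW z1).
have yd : del <= cmod (1 - zeta^* * z).
  have := ler_cmod_dist 1 (zeta^* * z); rewrite cmod1 cmodM cmod_conj.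
  move=> /(le_trans (ler_norm _)); apply: le_trans; apply: (le_trans x1).
  by rewrite lerD2l lerN2 ler_piMr ?cmod_ge0 // ltW.
have zc : cmod zeta^* <= 1 by rewrite cmod_conj ltW.
have kb1 := kern_lb (lexx 0) zc z1.
have kb2 := kern_lb (ltW d0) zc z1.
have k0 := kern_ge0 (lexx 0) zc z1.
have kd := kern_ge0 (ltW d0) zc z1.
rewrite cmod_conj add0r in kb1; rewrite cmod_conj in kb2.
set y := cmod (1 - _) in y0 yz yd kb1 kb2 *; set D := 1 - cmod z in D0 hb *.
have y2 : 0 < y ^+ 2 by rewrite exprn_gt0.
(* With y = |1 - conj(zeta) z| and D = 1 - |z|, [ln_blaschke_ge] is applied with a = 8 del D / y^2,
   as 1 - |zeta| <= 2 del; the first premise says a <= 1/2. *)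
have key : 16 * del * D <= y ^+ 2 -> 8 * del * D / y ^+ 2 <= Psi ->
    0 <= ln_blaschke zeta z + Psi.
  move=> e1 e2; have : - (8 * del * D / y ^+ 2) <= ln_blaschke zeta z; last by clear -e2; lra.
  apply: ln_blaschke_ge => //; last by rewrite ler_pdivrMr //; clear -e1; lra.
  rewrite -/y -/D divfK ?lt0r_neq0 //.
  have := ler_wpM2l (ltW D0) x2; clear; lra.
have iy2 : 0 < (y ^+ 2)^-1 by rewrite invr_gt0.
have P1 : 0 <= 32 * (del / M) * kern 0 zeta^* z by rewrite mulr_ge0 // mulr_ge0 // ltW.
have P2 : 0 <= 32 * (del ^+ 2 / M) / s `^ gam * v.
  by rewrite mulr_ge0 // divr_ge0 ?powR_ge0 // mulr_ge0 // divr_ge0 ?sqr_ge0 // ltW.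
have P3 : 0 <= 72 * (del / M) * kern d zeta^* z by rewrite mulr_ge0 // mulr_ge0 // ltW.
case: hb => [hD|hd].
- have Dm : D <= del / M * (m / s) by rewrite hD.
  have ze : cmod (z - e) <= y + 2 * s.
    by have := cmod_triangle z zeta e; clear -x4 yz; lra.
  have my : m <= y + 2 * s by rewrite /m ge_max ze /=; clear -y0 s0; lra.
  have Ms : D * (M * s) <= del * m.
    move: Dm; rewrite mulf_div ler_pdivlMr ?mulr_gt0 //.
  apply: key.
    have q1 : del * m <= del * y + del * (2 * s) by rewrite -mulrDr ler_pM2l.
    have q2 : del * del * y <= 2 * s * (y * y).
      by rewrite mulrA ler_pM2r //; apply: ler_pM => //; exact: ltW.
    have q3 : del * del <= y * y by apply: ler_pM => //; exact: ltW.
    have : 16 * del * D * (M * s) <= y ^+ 2 * (M * s).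
      have : 16 * del * (D * (M * s)) <= 16 * del * (del * y + del * (2 * s)).
        by rewrite ler_pM2l ?mulr_gt0 //; clear -Ms q1; lra.
      have : 16 * (2 * s * (y * y)) + 32 * s * (y * y) <= y ^+ 2 * (M * s).
        rewrite expr2 (_ : _ + _ = (y * y) * (64 * s)); last by ring.
        rewrite ler_pM2l ?mulr_gt0 // ler_pM2r //; clear -M0; lra.
      have : s * (del * del) <= s * (y * y) by rewrite ler_pM2l.
      clear -q2; lra.
    by rewrite ler_pM2r // mulr_gt0.
  (* For m <= 4 s the height D is at most 4 del / M, so the deficit 8 del D / y^2 is at most 32 (del
     / M) del / y^2, which the first kernel term dominates. *)
  have [m4|m4] := leP (m) (4 * s).
    have D4 : D <= 4 * (del / M).
      apply: (le_trans Dm); rewrite mulrC ler_pM2r // ler_pdivrMr //.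
    apply: (@le_trans _ _ (32 * (del / M) * kern 0 zeta^* z)); last by rewrite /Psi; clear -P2 P3; lra.
    have : 32 * (del / M) * (del / y ^+ 2) <= 32 * (del / M) * kern 0 zeta^* z.
      have c32 : 0 < 32 * (del / M) by rewrite mulr_gt0.
      rewrite (ler_pM2l c32); apply: (le_trans _ kb1).
      by rewrite add0r ler_pM2r.
    move=> hk; apply: (le_trans _ hk); rewrite [leRHS]mulrA ler_pM2r //.
    have : 8 * del * D <= 8 * del * (4 * (del / M)) by rewrite ler_pM2l ?mulr_gt0.
    clear; lra.
  (* Far from e, m <= y + 2 s and 4 s < m give m <= 2 y; hence 8 del D / y^2 <= 32 del D / m^2, and
     inserting the value of D yields the coefficient of v. *)
  have mE : m = cmod (z - e).
    by move: m4; rewrite /m; case: (leP (cmod (z - e)) s) => [h1 h2|//]; exfalso; clear -h2 s0; lra.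
  apply: (@le_trans _ _ (32 * (del ^+ 2 / M) / s `^ gam * v)); last by rewrite /Psi; clear -P1 P3; lra.
  have sz : s <= cmod (z - e) by rewrite -mE.
  have hE := hv sz; rewrite -mE in hE.
  have cs : 0 < 32 * (del ^+ 2 / M) / s `^ gam.
    by rewrite !mulr_gt0 ?invr_gt0 ?exprn_gt0.
  move: hE; rewrite -(ler_pM2l cs) => hE; apply: (le_trans _ hE).
  have y2m : m <= 2 * y by clear -my m4; lra.
  have -> : m `^ (- (2 - gam)) = m `^ gam / m ^+ 2.
    rewrite opprB powRB ?(lt0r_neq0 m0) ?implybT //.
    by rewrite -(@powR_mulrn _ _ 2) // ltW.
  rewrite ler_pdivrMr // hD /t.
  have m2' : m ^+ 2 <= 4 * y ^+ 2.
    by rewrite (_ : 4 * y ^+ 2 = (2 * y) ^+ 2) ?lerXn2r ?nnegrE ?mulr_ge0 ?(ltW y0) ?(ltW m0) //; ring.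
  set A := m `^ gam; have A0 : 0 < A by exact: powR_gt0.
  have mz2 : 0 < m ^+ 2 by rewrite exprn_gt0.
  have B0 : 0 < 8 * del ^+ 2 / (M * s `^ gam) * A / m ^+ 2.
    by rewrite !mulr_gt0 ?invr_gt0 ?mulr_gt0 ?exprn_gt0.
  have := ler_wpM2l (ltW B0) m2'.
  rewrite divfK ?lt0r_neq0 // => /le_trans h.
  rewrite (_ : 8 * del * _ = 8 * del ^+ 2 / (M * s `^ gam) * A); last by ring.
  apply: h; rewrite le_eqVlt; apply/orP; left; apply/eqP.
  by field; rewrite !lt0r_neq0.
(* Close to F, D <= d / M. As zeta is at distance at least d from F, y >= d / 2 and d + y <= 3 y; so
   the last kernel is at least d / (9 y^2), and 72 = 8 * 9. *)
have Dd : D <= d / M by rewrite -hd; exact: cdist_ge_1B.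
have dM2 : d / M <= d / 2 by rewrite ler_pM2l // lef_pV2 ?posrE //; clear -M0; lra.
have yd2 : d <= 2 * y.
  have := cdist_lip zeta z F0; rewrite hd cmodB => /(le_trans (ler_norm _)); clear -x5 dM2 yz; lra.
have Md : D * M <= d by rewrite -ler_pdivlMr.
apply: key.
  have dd4 : d * d <= 4 * (y * y) by clear -yd2 d0 y0; nra.
  have : 16 * del * D * M <= y ^+ 2 * M.
    have : 16 * del * (D * M) <= 16 * (2 * d) * d.
      by apply: ler_pM => //; rewrite ?mulr_ge0 ?(ltW del0) ?(ltW D0) ?(ltW Mp) //; clear -dd; lra.
    have : y * y * 208 <= y * y * M by rewrite ler_pM2l ?mulr_gt0.
    by move: y2; rewrite expr2; clear -dd4; lra.
  by rewrite ler_pM2r.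
apply: (@le_trans _ _ (72 * (del / M) * kern d zeta^* z)); last by rewrite /Psi; clear -P1 P2; lra.
have kd9 : d / (9 * y ^+ 2) <= kern d zeta^* z.
  have dy0 : 0 < d + y by rewrite addr_gt0.
  apply: (@le_trans _ _ (d / (d + y) ^+ 2)); last first.
    by apply: (le_trans _ kb2); rewrite ler_pM2r ?invr_gt0 ?exprn_gt0 //; clear -zt1; lra.
  rewrite ler_pM2l // lef_pV2 ?posrE ?mulr_gt0 ?exprn_gt0 //.
  rewrite (_ : 9 * y ^+ 2 = (3 * y) ^+ 2); last by ring.
  by rewrite lerXn2r ?nnegrE ?addr_ge0 ?mulr_ge0 ?(ltW y0) ?(ltW d0) //; clear -yd2; lra.
have c72 : 0 < 72 * (del / M) by rewrite mulr_gt0.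
move: kd9; rewrite -(ler_pM2l c72) => hk; apply: (le_trans _ hk).
rewrite (_ : 72 * _ * _ = 8 * del * (d / M) / y ^+ 2); last first.
  by field; rewrite !lt0r_neq0.
by rewrite ler_pM2r // ler_pM2l ?mulr_gt0.
Qed.

(** [alpha] is any admissible exponent, as the supremum [AC_type F] may fail to be attained; [beta]
    stands for min(p, r), lowered so that gam = beta / p < 1. The constant is uniform in e, f, K, Z
    and the three scales, as the summation over classes requires. *)
Lemma class_bound (R : realType) (F : set R[i]) (alpha p q r beta eta : R) :
  F !=set0 -> F `<=` @on_circle R -> bigO_at0 F alpha ->
  0 <= p -> 0 <= q -> 0 <= beta -> beta <= r -> beta = 0 \/ beta < p ->
  0 < eta -> 0 <= alpha - q + eta ->
  exists2 C : R, 0 < C & forall e : R[i], on_circle e ->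
  forall (f : R[i] -> R[i]) (K : R) (Z : seq R[i]) (del s d : R),
  0 < K -> analytic_on_disk f -> cmod (f 0) = 1 ->
  (forall z, cmod z < 1 -> ln (cmod (f z)) <=
     K / (1 - cmod z) `^ p * (cmod (z - e) `^ r / cdist z F `^ q)) ->
  0 < del -> 0 < s -> 0 < d ->
  (forall zeta, zeta \in Z -> [/\ cmod zeta < 1, del <= 1 - cmod zeta <= 2 * del,
     s <= cmod (zeta - e) <= 2 * s & d <= cdist zeta F <= 2 * d]) ->
  (forall zeta, zeta \in Z ->
     exists2 m, zero_order f zeta m & (count_mem zeta Z <= m)%N) ->
  (size Z)%:R * del <= C * K * (del `^ (- p) * s `^ beta * d `^ (- eta)).
Proof.
move=> F0 FT Fo p0 q0 b0 br bp eta0 etaq.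
(* for p = 0 we have beta = 0, and beta / p = 0 *)
pose gam := beta / p.
have [gam0 gam1] : 0 <= gam /\ gam < 1.
  rewrite /gam; case: (bp) => [->|h]; first by rewrite mul0r lexx ltr01.
  by split; [rewrite divr_ge0|rewrite ltr_pdivrMr ?mul1r //; exact: le_lt_trans h].
have gamp : gam * p = beta.
  rewrite /gam; case: (bp) => [->|h]; first by rewrite !mul0r.
  by rewrite divfK // lt0r_neq0 //; exact: le_lt_trans h.
have [CF CF0 netF] := net_exists FT Fo.
have majF := majorant_exists F0 FT q0 eta0 etaq netF.
set AF := 25 * CF * 2 `^ (alpha - q + eta) / (1 - 2 `^ (- eta)) in majF.
(* The constant of [majorant_exists] for the set {e}: nets of one point give C = alpha = 1, and q =
   2 - gam, eta = 1 - gam satisfy alpha - q + eta = 0, with eta > 0 because gam < 1. *)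
pose CE : R := 25 * 1 * 2 `^ (1 - (2 - gam) + (1 - gam)) / (1 - 2 `^ (- (1 - gam))).
have pow2 (a : R) : 0 < a -> 0 < 1 - 2 `^ (- a).
  move=> a0; have p1 : 1 `^ a = 1 :> R by rewrite powR1.
  rewrite subr_gt0 powRN invf_lt1 ?powR_gt0 // -[ltLHS]p1.
  by apply: gt0_ltr_powR; rewrite ?nnegrE ?ltr1n ?ler0n ?ler01.
have AF0 : 0 < AF by rewrite divr_gt0 ?pow2 // !mulr_gt0 ?powR_gt0.
clearbody AF.
have CE0 : 0 <= CE by rewrite divr_ge0 ?mulr_ge0 ?powR_ge0 // ltW // pow2 // subr_gt0.
(* 104 + 64 CE bounds M (Psi zeta 0) / del below *)
pose M := 208 + 128 * CE.
have M0 : 208 <= M by rewrite /M; lra.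
have Mp : 0 < M by lra.
have two : 0 < 2 :> R by [].
exists (2 * (2 `^ r * M `^ p) * (AF * M `^ eta)).
  by apply: mulr_gt0; apply: mulr_gt0 => //; [apply: mulr_gt0|]; exact: powR_gt0.
move=> e eT f K Z del s d K0 fa f1 fK del0 s0 d0 hZ hZm.
have [->|Zne] := eqVneq Z [::].
  by rewrite mul0r !mulr_ge0 ?powR_ge0 // ltW.
(* Any zero of the class ties the scales together, as 1 - |zeta| is at most |zeta - e| and at most
   dist(zeta, F). *)
have [del1 ds dd s2 d2] : [/\ del <= 1, del <= 2 * s, del <= 2 * d, s < 2 & d < 2].
  case: (Z) Zne hZ => // zeta Z' _ /(_ zeta (mem_head _ _))[z1 /andP[h1 h2] /andP[h3 h4] /andP[h5 h6]].
  have k1 := cdist_ge_1B F0 FT zeta; have k2 := cdist_lt2 F0 FT z1.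
  have k3 : 1 - cmod zeta <= cmod (zeta - e).
    by have := ler_cmod_dist e zeta; rewrite eT cmodB => /(le_trans (ler_norm _)).
  have k4 : cmod (zeta - e) < 2.
    by apply: le_lt_trans (ler_cmodB _ _) _; rewrite eT; clear -z1; lra.
  by have := cmod_ge0 zeta; clear -h1 h2 h3 h4 h5 h6 k1 k2 k3 k4; split; lra.
pose m z := Num.max (cmod (z - e)) s.
pose t := del / (M * s `^ gam).
have sg0 : 0 < s `^ gam by exact: powR_gt0.
have t0 : 0 < t by rewrite divr_gt0 // mulr_gt0.
have ms z : s <= m z by rewrite /m le_max lexx orbT.
have me z : cmod (z - e) <= m z by rewrite /m le_max lexx.
have m0 z : 0 < m z by exact: lt_le_trans (ms z).
have m2 z : cmod z < 1 -> m z <= 2.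
  move=> z1; rewrite /m ge_max (ltW s2) andbT.
  by apply: le_trans (ler_cmodB _ _) _; rewrite eT; clear -z1; lra.
have tm z : t * m z `^ gam <= del / M * (m z / s) by exact: height_le.
(* The domain is where g >= 0. At a zero of g one of the two constraints is an equality; these are
   the two alternatives of [blaschke_correction]. *)
pose g z := Num.min (1 - cmod z - t * m z `^ gam) (cdist z F - d / M).
have g1 z : 0 <= g z -> t * m z `^ gam <= 1 - cmod z /\ d / M <= cdist z F.
  by rewrite /g le_min => /andP[]; clear; split; lra.
have g1' z : 0 <= g z -> cmod z < 1.
  by move=> /g1[h _]; have := mulr_gt0 t0 (powR_gt0 gam (m0 z)); clear -h; lra.
have gc z : ccont g z.
  have mc : ccont m z.
    apply: ccont_max; last exact: ccont_cst.
    apply: (@lip_ccont _ _ _ 1 1) => // x _; rewrite mul1r.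
    by apply: le_trans (ler_cmod_dist _ _) _; rewrite (_ : z + x - e - (z - e) = x) //; ring.
  have gE : g = fun x => Num.min (1 + - 1 * cmod x + - t * expR (gam * ln (m x)))
      (cdist x F + - (d / M)).
    by apply/funext => x; rewrite /g /powR (gt_eqF (m0 x)) mulN1r mulNr.
  have ac : ccont (fun x => 1 + - 1 * cmod x + - t * expR (gam * ln (m x))) z.
    apply: ccontD; last first.
      apply: ccontM; first exact: ccont_cst.
      apply: (@ccont_comp _ (fun v => expR (gam * ln v)) m _ mc).
      apply: (@continuous_comp _ _ _ (fun v => gam * ln v) expR); last exact: continuous_expR.
      by apply: cvgMr; exact: continuous_ln.
    by apply: ccontD; [|apply: ccontM]; [exact: ccont_cst..|exact: ccont_cmod_id].
  have bc : ccont (fun x => cdist x F + - (d / M)) z.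
    by apply: ccontD; [exact: ccont_cdist|exact: ccont_cst].
  by rewrite gE; exact: ccont_min.
have g00 : 0 <= g 0.
  rewrite /g le_min cmod0 (cdist0 F0 FT) !subr_ge0; apply/andP; split; last first.
    by rewrite ler_pdivrMr // mul1r; lra.
  rewrite subr0; apply: le_trans (tm 0) _.
  rewrite mulf_div ler_pdivrMr ?mulr_gt0 // mul1r.
  have : m 0 <= 1 + s by rewrite /m ge_max sub0r cmodN eT; lra.
  have := m0 0; nra.
have [PhiF [PFr PF0 PFl PFz]] := majF (d / M) (divr_gt0 d0 Mp).
have [PhiE [PEr PE0 PEl PEz]] : exists Phi : R[i] -> R,
  [/\ forall z, cmod z < 1 -> regular_at Phi z, forall z, cmod z < 1 -> 0 <= Phi z,
      forall z, cmod z < 1 -> s <= cdist z [set e] -> cdist z [set e] `^ (- (2 - gam)) <= Phi z &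
      Phi 0 <= CE * s `^ (- (1 - gam))].
  apply: (@majorant_exists _ [set e] 1 1) => //.
  - by exists e.
  - by move=> _ ->.
  - by lra.
  - by rewrite subr_gt0.
  - by lra.
  - move=> u u0 _; exists [:: e]; last by rewrite /= !mul1r powRr1 // ltW.
    split=> [zeta|w ->]; first by rewrite inE => /eqP ->.
    by exists e; rewrite ?mem_head // subrr cmod0 ltW.
pose Psi zeta z := 32 * (del / M) * kern 0 zeta^* z +
  (32 * (del ^+ 2 / M) / s `^ gam * PhiE z + 72 * (del / M) * kern d zeta^* z).
(* On the domain (1 - |z|)^p >= t^p m^beta because gam p = beta, while |z - e|^r <= 2^r m^beta. The
   powers of m cancel and L = 2^r t^(-p) is left. *)
pose L := 2 `^ r * M `^ p * (del `^ (- p) * s `^ beta).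
have L0 : 0 < L by rewrite !mulr_gt0 ?powR_gt0.
have dM : 0 < del / M by rewrite divr_gt0.
have Zc zeta : zeta \in Z -> cmod zeta^* <= 1.
  by move=> /hZ[h _ _ _]; rewrite cmod_conj ltW.
have PsiR zeta z : zeta \in Z -> cmod z < 1 -> regular_at (Psi zeta) z.
  move=> hz z1; apply: regularD; first by apply: regularZ; apply: kern_regular => //; exact: Zc.
  apply: regularD; first by apply: regularZ; exact: PEr.
  by apply: regularZ; apply: kern_regular; [exact: ltW|exact: Zc|].
have PhiR z : cmod z < 1 -> regular_at (fun x => K * L * PhiF x) z.
  by move=> z1; apply: regularZ; exact: PFr.
have Phib z : g z = 0 -> f z != 0 -> ln (cmod (f z)) <= K * L * PhiF z.
  move=> gz _; have gz' : 0 <= g z by rewrite gz.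
  have z1 := g1' _ gz'; have [h1 h2] := g1 _ gz'.
  apply: le_trans (fK z z1) _.
  have hF := PFl z z1 h2; rewrite powRN in hF.
  have D0 : 0 < 1 - cmod z by rewrite subr_gt0.
  rewrite -mulrA [leRHS](_ : _ = K * (L * PhiF z)); last by ring.
  rewrite ler_pM2l // mulrA; apply: ler_pM => //.
  - by rewrite mulr_ge0 ?invr_ge0 ?powR_ge0.
  - by rewrite invr_ge0 powR_ge0.
  rewrite mulrC ler_pdivrMr ?powR_gt0 //.
  have hm : cmod (z - e) `^ r <= 2 `^ r * m z `^ beta.
    apply: (@le_trans _ _ (m z `^ r)).
      by apply: ge0_ler_powR; rewrite ?nnegrE ?cmod_ge0 ?(ltW (m0 z)) //; exact: le_trans b0 br.
    have -> : m z `^ r = m z `^ (r - beta) * m z `^ beta.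
      by rewrite -powRD ?subrK // (lt0r_neq0 (m0 z)) implybT.
    rewrite ler_pM2r ?powR_gt0 //; apply: (@le_trans _ _ (2 `^ (r - beta))).
      by apply: ge0_ler_powR; rewrite ?nnegrE ?subr_ge0 // ?m2 // ltW.
    by apply: ler_powR; rewrite ?ler1n // gerBl.
  have hD : (t * m z `^ gam) `^ p <= (1 - cmod z) `^ p.
    apply: ge0_ler_powR; rewrite ?nnegrE // ?(ltW D0) // mulr_ge0 ?powR_ge0 //; exact: ltW.
  apply: (le_trans hm); apply: le_trans (ler_wpM2l (ltW L0) hD).
  rewrite powRM ?powR_ge0 ?(ltW t0) // -powRrM gamp /t.
  rewrite powRM ?invr_ge0 ?mulr_ge0 ?powR_ge0 ?(ltW Mp) ?(ltW del0) //.
  rewrite powR_invl ?mulr_ge0 ?powR_ge0 ?(ltW Mp) //.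
  rewrite powRM ?powR_ge0 ?(ltW Mp) // -powRrM gamp /L powRN le_eqVlt; apply/orP; left; apply/eqP.
  by field; rewrite !lt0r_neq0 ?powR_gt0.
have Psib zeta z : zeta \in Z -> g z = 0 -> 0 <= ln_blaschke zeta z + Psi zeta z.
  move=> hz gz; have gz' : 0 <= g z by rewrite gz.
  have z1 := g1' _ gz'; have [zt1 x12 x34 /andP[x5 _]] := hZ zeta hz.
  apply: (@blaschke_correction _ F e zeta z gam M del s d) => //.
  - exact: PE0.
  - by move=> sz; have := PEl z z1; rewrite cdist_set1; apply.
  - move: gz; rewrite /g; case: (leP (1 - cmod z - t * m z `^ gam) (cdist z F - d / M)) => _ /eqP; rewrite subr_eq0 => /eqP; [left|right] => //.
have Z1 zeta : zeta \in Z -> cmod zeta < 1 by move=> /hZ[].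
have J := jensen_bound fa f1 gc g1' g00 Z1 hZm PsiR PhiR Psib Phib.
(* Here -ln |zeta| >= 1 - |zeta| >= del, and M is chosen so that the three parts of Psi at 0 add up
   to at most del / 2. *)
have Zn zeta : zeta \in Z -> del / 2 <= - ln (cmod zeta) - Psi zeta 0.
  move=> hz; have [zt1 /andP[x1 x2] _ _] := hZ zeta hz.
  (* As ln 0 is 0 by convention, zeta = 0 has to be excluded; f does not vanish at 0. *)
  have z0 : 0 < cmod zeta.
    rewrite cmod_gt0; apply/eqP => zE; have [k zo ck] := hZm zeta hz.
    have kp : (0 < k)%N by apply: leq_trans ck; rewrite -has_count has_pred1.
    by have := zero_order_root zt1 zo kp; rewrite zE => E; move: f1; rewrite E cmod0; clear; lra.
  have hl : ln (cmod zeta) <= cmod zeta - 1.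
    have := @le_ln1Dx R (cmod zeta - 1); rewrite addrCA subrr addr0 => ->//; clear -z0; lra.
  have h1 : 32 * (del / M) * kern 0 zeta^* 0 <= 32 * (del / M).
    by rewrite ler_piMr ?(mulr_ge0 _ (ltW dM)) //; apply: kern0_le1 => //; exact: Zc.
  have h3 : 72 * (del / M) * kern d zeta^* 0 <= 72 * (del / M).
    by rewrite ler_piMr ?(mulr_ge0 _ (ltW dM)) //; apply: kern0_le1; rewrite ?(ltW d0) // Zc.
  have h2 : 32 * (del ^+ 2 / M) / s `^ gam * PhiE 0 <= 64 * CE * (del / M).
    have cs : 0 < 32 * (del ^+ 2 / M) / s `^ gam.
      by rewrite !mulr_gt0 ?invr_gt0 ?exprn_gt0.
    move: PEz; rewrite -(ler_pM2l cs) => /le_trans; apply.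
    have -> : s `^ (- (1 - gam)) = s `^ gam / s.
      rewrite opprB powRB ?(lt0r_neq0 s0) ?implybT // powRr1 //; exact: ltW.
    rewrite (_ : 32 * _ / _ * _ = 32 * CE * (del / M) * (del / s)); last first.
      by field; rewrite !lt0r_neq0.
    have ds' : del / s <= 2 by rewrite ler_pdivrMr.
    have c0 : 0 <= 32 * CE * (del / M) by rewrite (mulr_ge0 _ (ltW dM)) // mulr_ge0.
    by have := ler_wpM2l c0 ds'; clear; lra.
  have hM : (104 + 64 * CE) * (del / M) = del / 2.
    by rewrite /M; move: CE0; clearbody CE; clear => CE0; field; lra.
  have -> : Psi zeta 0 = 32 * (del / M) * kern 0 zeta^* 0 +
     (32 * (del ^+ 2 / M) / s `^ gam * PhiE 0 + 72 * (del / M) * kern d zeta^* 0) by [].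
  by clear -x1 hl h1 h2 h3 hM; lra.
have : (size Z)%:R * (del / 2) <= K * L * (AF * (d / M) `^ (- eta)).
  apply: (@le_trans _ _ (K * L * PhiF 0)); last by rewrite (ler_pM2l (mulr_gt0 K0 L0)).
  apply: le_trans J; rewrite -sum1_size natr_sum big_distrl /= big_seq [leRHS]big_seq.
  by apply: ler_sum => zeta hz; rewrite mul1r; exact: Zn.
rewrite powRM ?invr_ge0 ?(ltW d0) ?(ltW Mp) // powR_invl ?(ltW Mp) // [M `^ (- eta)]powRN invrK.
by rewrite /L; clear; lra.
Qed.

(** * Summation over dyadic classes *)

Section DyadicSum.
Context {R : realType}.

Lemma sum_partition_nat (I : eqType) (s : seq I) (P : pred I) (G : I -> R) (h : I -> nat) N :
  (forall i, i \in s -> P i -> (h i < N)%N) ->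
  \sum_(i <- s | P i) G i = \sum_(n < N) \sum_(i <- s | P i && (h i == n)) G i.
Proof.
move=> hN; rewrite (exchange_big_dep P) /= => [|n i _ /andP[]//]; rewrite big_seq_cond [RHS]big_seq_cond.
apply: eq_bigr => i /andP[si Pi].
rewrite (big_pred1 (Ordinal (hN i si Pi))) // => n.
by rewrite Pi /= -val_eqE /= eq_sym.
Qed.

(** A finite list meets finitely many classes, and the geometric weights keep their number out of
    the bound. *)
Lemma sum_geometric_classes (I : eqType) (s : seq I) (P : pred I) (G : I -> R)
  (h : I -> nat) (c w : R) : 0 <= c -> 0 <= w -> w < 1 ->
  (forall n, \sum_(i <- s | P i && (h i == n)) G i <= c * w ^+ n) ->
  \sum_(i <- s | P i) G i <= c / (1 - w).
Proof.
move=> c0 w0 w1 H; rewrite (@sum_partition_nat _ s P G h (\max_(i <- s) h i).+1); last first.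
  by move=> i si _; rewrite ltnS; exact: leq_bigmax_seq.
apply: (@le_trans _ _ (\sum_(n < (\max_(i <- s) h i).+1) c * w ^+ n)); first exact: ler_sum.
by rewrite -big_distrr /= ler_wpM2l // sum_geometric_le.
Qed.

Lemma powR_exprn (x a : R) n : 0 <= x -> (x ^+ n) `^ a = (x `^ a) ^+ n.
Proof.
by move=> x0; rewrite -powR_mulrn // -powRrM mulrC powRrM powR_mulrn // powR_ge0.
Qed.

Lemma dyadic_index (x : R) : 0 < x -> x < 2 ->
  exists n, 2^-1 ^+ n <= x <= 2 * 2^-1 ^+ n.
Proof.
move=> x0 x2.
have ex : exists n, 2^-1 ^+ n <= x.
  exists (Num.Def.archi_bound x^-1).
  rewrite exprVn -[leRHS]invrK lef_pV2 ?posrE ?invr_gt0 ?exprn_gt0 //.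
  by apply: ltW; exact: upper_nthrootP.
case: (ex_minnP ex) => -[|n] hn hmin; first by exists 0%N; rewrite hn expr0 mulr1 ltW.
exists n.+1; rewrite hn exprS mulrA divff // mul1r.
by rewrite leNgt; apply/negP => /ltW/hmin; rewrite ltnn.
Qed.

(** In logarithms this is linear. On the left D has the exponent eps, while S and B have at worst
    -eps / 6, coming from [beta] and from the eta of the majorant. Raising both to +eps / 6 takes 2
    eps / 6 each, drawn from D through D <= 2 S and D <= 2 B; with the eps / 6 kept by D itself,
    five sixths of eps are spent. *)
Lemma class_weight_le (D S B p eps beta r' w : R) :
  0 < D -> D <= 1 -> 0 < S -> S <= 1 -> 0 < B -> B <= 1 -> D <= 2 * S -> D <= 2 * B ->
  0 < eps -> r' - eps / 6 <= beta ->
  D `^ (- p) * S `^ beta * B `^ (- (w + eps / 6)) / D *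
    ((2 * D) `^ (p + 1 + eps) * ((2 * B) `^ w / S `^ r')) <=
  2 `^ (p + 1 + 2 * eps + w) * (D `^ (eps / 6) * S `^ (eps / 6) * B `^ (eps / 6)).
Proof.
move=> D0 D1 S0 S1 B0 B1 DS DB e0 hb.
have powE (x a : R) : 0 < x -> x `^ a = expR (a * ln x).
  by move=> x0; rewrite /powR gt_eqF.
have two : 0 < 2 :> R by [].
have DE : D^-1 = expR (- ln D) by rewrite expRN lnK.
rewrite DE -powRN !powE ?mulr_gt0 // -!expRD ler_expR !lnM ?posrE //.
have lD : ln D <= 0 by rewrite ln_le0.
have lS : ln S <= 0 by rewrite ln_le0.
have l2 : 0 <= ln 2 :> R by rewrite ln_ge0 // ler1n.
have hDS : ln D <= ln 2 + ln S by rewrite -lnM ?posrE // ler_ln ?posrE ?mulr_gt0.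
have hDB : ln D <= ln 2 + ln B by rewrite -lnM ?posrE // ler_ln ?posrE ?mulr_gt0.
have h1 := ler_wpM2l (ltW e0) hDS.
have h2 := ler_wpM2l (ltW e0) hDB.
have h3 := mulr_ge0_le0 (ltW e0) lD.
have h5 := mulr_ge0 (ltW e0) l2.
have h4 : (beta - r' + eps / 6) * ln S <= 0 by rewrite mulr_ge0_le0 //; lra.
move: (ln D) (ln S) (ln B) (ln 2) h1 h2 h3 h4 h5 => a b c d; lra.
Qed.

End DyadicSum.

(** * Multiplicities encoded by pairs *)

Section Multiplicity.
Context {R : realType}.

(** Distinct pairs over the same zeta have distinct second components, all smaller than a common
    order of vanishing m, so there are at most m of them. *)
Lemma count_zeros_mult (f : R[i] -> R[i]) (s : seq (R[i] * nat)) (P : pred (R[i] * nat)) zeta :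
  uniq s -> (forall pk, pk \in s -> zeros_mult f pk) ->
  zeta \in [seq pk.1 | pk <- s & P pk] ->
  exists2 m, zero_order f zeta m & (count_mem zeta [seq pk.1 | pk <- s & P pk] <= m)%N.
Proof.
move=> us hs /mapP[pk0]; rewrite mem_filter => /andP[_ pks] zE.
pose L := [seq pk.2 | pk <- s & pk.1 == zeta].
have uL : uniq L.
  rewrite map_inj_in_uniq ?filter_uniq // => -[x k] [y l]; rewrite !mem_filter /=.
  by move=> /andP[/eqP-> _] /andP[/eqP-> _] ->.
(* Each pair comes with its own witness m; the largest one bounds all second components at once. *)
have ub (T : seq nat) : (forall k, k \in T -> exists m, zero_order f zeta m /\ (k < m)%N) ->
    T != [::] -> exists2 m, zero_order f zeta m & forall k, k \in T -> (k < m)%N.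
  elim: T => // k T IH hT _.
  have [m [zm km]] := hT k (mem_head _ _).
  have [->|T0] := eqVneq T [::].
    by exists m => // j; rewrite inE => /eqP ->.
  have [|m' zm' hm'] := IH _ T0; first by move=> j jT; apply: hT; rewrite inE jT orbT.
  have [le|/ltnW le] := leqP m m'.
    exists m' => // j; rewrite inE => /orP[/eqP->|]; [exact: leq_trans le|exact: hm'].
  exists m => // j; rewrite inE => /orP[/eqP->//|/hm' h]; exact: leq_trans le.
have [||m zm hm] := ub L.
- move=> k /mapP[[x l]]; rewrite mem_filter /= => /andP[/eqP-> xs] ->.
  by have [_ [m hm]] := hs _ xs; exists m.
- have : pk0.2 \in L by apply: map_f; rewrite mem_filter pks zE eqxx.
  by case: (L).
exists m => //; rewrite count_map count_filter.
apply: (@leq_trans (size L)).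
  rewrite size_map size_filter; apply: sub_count => pk /andP[] //.
rewrite -(size_iota 0 m); apply: uniq_leq_size => // k /hm; by rewrite mem_iota add0n.
Qed.

End Multiplicity.

(** Finite lists suffice, a sum of nonnegative terms being the supremum of its finite parts. Classes
    are indexed by the nearest point of E and three dyadic exponents, whence the factor [size E] and
    three geometric series of ratio omega. *)
Lemma zero_sum_le (R : realType) (E : seq R[i]) (F : set R[i]) (p q r eps : R) :
  E != [::] -> (forall zeta, zeta \in E -> on_circle zeta) ->
  F !=set0 -> F `<=` @on_circle R -> 0 <= p -> 0 <= q -> 0 <= r -> 0 < eps ->
  exists C : R, 0 < C /\
  forall (f : R[i] -> R[i]) (K : R), 0 < K -> analytic_on_disk f -> cmod (f 0) = 1 ->
    (forall z, cmod z < 1 -> ln (cmod (f z)) <=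
       K / (1 - cmod z) `^ p * (cdist z [set v | v \in E] `^ r / cdist z F `^ q)) ->
    forall s : seq (R[i] * nat), uniq s -> (forall zk, zk \in s -> zeros_mult f zk) ->
    \sum_(zk <- s) (1 - cmod zk.1) `^ (p + 1 + eps) *
      (cdist zk.1 F `^ Num.max (q - AC_type F + eps) 0 /
       cdist zk.1 [set v | v \in E] `^ Num.min p r) <= C * K.
Proof.
move=> E0 ET F0 FT p0 q0 r0 eps0.
set w := Num.max _ 0; set r' := Num.min p r.
(* The eps in the exponent of dist(zeta, F) pays for alpha > [AC_type F] - eps; the further eps / 6
   in w + eps / 6 keeps this exponent positive even if w = 0. *)
have [alpha Fo ha] := AC_type_adherent F eps0.
have w0 : 0 <= w by rewrite /w le_max lexx orbT.
have wq : q - AC_type F + eps <= w by rewrite /w le_max lexx.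
have r'0 : 0 <= r' by rewrite /r' le_min p0.
have r'p : r' <= p by rewrite /r' ge_min lexx.
have r'r : r' <= r by rewrite /r' ge_min lexx orbT.
pose beta := Num.max (r' - eps / 6) 0.
have b0 : 0 <= beta by rewrite /beta le_max lexx orbT.
have br' : r' - eps / 6 <= beta by rewrite /beta le_max lexx.
have br : beta <= r by rewrite /beta ge_max r0 andbT; lra.
have bp : beta = 0 \/ beta < p.
  by rewrite /beta; case: (leP (r' - eps / 6) 0) => _; [left|right; lra].
have eta0 : 0 < w + eps / 6 by lra.
have etaq : 0 <= alpha - q + (w + eps / 6) by lra.
have [C C0 HC] := class_bound F0 FT Fo p0 q0 b0 br bp eta0 etaq.
pose omega : R := 2^-1 `^ (eps / 6).
have om0 : 0 <= omega by exact: powR_ge0.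
have om1 : omega < 1.
  have p1 : 1 `^ (eps / 6) = 1 :> R by rewrite powR1.
  rewrite /omega -[ltRHS]p1; apply: gt0_ltr_powR; rewrite ?nnegrE ?invr_ge0 ?ler0n ?ler01 //.
    by lra.
  by rewrite invf_lt1 ?ltr1n.
pose Q : R := C * 2 `^ (p + 1 + 2 * eps + w).
have Q0 : 0 < Q by rewrite mulr_gt0 ?powR_gt0.
have om2 : 0 < 1 - omega by lra.
exists ((size E)%:R * (Q / (1 - omega) / (1 - omega) / (1 - omega))); split.
  by rewrite mulr_gt0 ?ltr0n ?lt0n ?size_eq0 // !divr_gt0.
move=> f K K0 fa f1 fK s us hs.
have /choice[near Hnear] : forall z, exists e, e \in E /\ cdist z [set v | v \in E] = cmod (z - e).
  by move=> z; have [e eE h] := cdist_seq z E0; exists e.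
have /choice[ind Hind] : forall x : R, exists n, 0 < x -> x < 2 -> 2^-1 ^+ n <= x <= 2 * 2^-1 ^+ n.
  move=> x; have [x0|x0] := ltP 0 x; last by exists 0%N; lra.
  have [x2|x2] := ltP x 2; last by exists 0%N; lra.
  by have [n hn] := dyadic_index x0 x2; exists n.
pose G (zk : R[i] * nat) := (1 - cmod zk.1) `^ (p + 1 + eps) *
      (cdist zk.1 F `^ w / cdist zk.1 [set v | v \in E] `^ r').
pose h1 (zk : R[i] * nat) := index (near zk.1) E.
pose h2 (zk : R[i] * nat) := ind (1 - cmod zk.1).
pose h3 (zk : R[i] * nat) := ind (cmod (zk.1 - near zk.1)).
pose h4 (zk : R[i] * nat) := ind (cdist zk.1 F).
have main (a b c d : nat) : (a < size E)%N ->
  \sum_(zk <- s | (((h1 zk == a) && (h2 zk == b)) && (h3 zk == c)) && (h4 zk == d)) G zk <=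
    Q * K * omega ^+ b * omega ^+ c * omega ^+ d.
  move=> aE.
  pose P zk := (((h1 zk == a) && (h2 zk == b)) && (h3 zk == c)) && (h4 zk == d).
  rewrite (eq_bigl P) //.
  pose e := nth 0 E a; pose Z := [seq zk.1 | zk <- s & P zk].
  have half1 n : (2^-1 : R) ^+ n <= 1 by rewrite exprn_ile1 // ?invr_ge0 // invf_le1 // ler1n.
  have half0 n : 0 < (2^-1 : R) ^+ n by rewrite exprn_gt0 // invr_gt0.
  have eT : on_circle e by apply: ET; exact: mem_nth.
  have [D DE] : exists D : R, D = 2^-1 ^+ b by exists (2^-1 ^+ b).
  have [S SE] : exists S : R, S = 2^-1 ^+ c by exists (2^-1 ^+ c).
  have [B BE] : exists B : R, B = 2^-1 ^+ d by exists (2^-1 ^+ d).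
  have [D0 S0 B0] : [/\ 0 < D, 0 < S & 0 < B] by rewrite DE SE BE !half0.
  have [D1 S1 B1] : [/\ D <= 1, S <= 1 & B <= 1] by rewrite DE SE BE !half1.
  have geo zk : zk \in s -> P zk -> [/\ cmod zk.1 < 1, D <= 1 - cmod zk.1 <= 2 * D,
      S <= cmod (zk.1 - e) <= 2 * S, B <= cdist zk.1 F <= 2 * B &
      cdist zk.1 [set v | v \in E] = cmod (zk.1 - e)].
    move=> zs /andP[/andP[/andP[/eqP i1 /eqP i2] /eqP i3] /eqP i4].
    have [z1 _] := hs zk zs; have [nE nd] := Hnear zk.1.
    have ne : near zk.1 = e by rewrite /e -i1 /h1 nth_index.
    have zc := cmod_ge0 zk.1.
    have le1 : 1 - cmod zk.1 <= cmod (zk.1 - e).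
      by have := ler_cmod_dist e zk.1; rewrite eT cmodB => /(le_trans (ler_norm _)).
    have lt2 : cmod (zk.1 - e) < 2.
      by apply: le_lt_trans (ler_cmodB _ _) _; rewrite eT; clear -z1; lra.
    have dF := cdist_ge_1B F0 FT zk.1; have dF2 := cdist_lt2 F0 FT z1.
    split => //; last by rewrite nd ne.
    - by rewrite DE -i2 /h2; apply: Hind; clear -z1 zc; lra.
    - by rewrite SE -i3 /h3 ne; apply: Hind => //; clear -z1 le1; lra.
    - by rewrite BE -i4 /h4; apply: Hind => //; clear -z1 dF; lra.
  have [Znil|Zne] := eqVneq [seq zk <- s | P zk] [::].
    by rewrite -big_filter Znil big_nil !mulr_ge0 ?exprn_ge0 // ltW.
  have [DS DB] : D <= 2 * S /\ D <= 2 * B.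
    have [zk] : exists zk, zk \in [seq zk <- s | P zk].
      by case: [seq _ <- _ | _] Zne => // zk ? _; exists zk; exact: mem_head.
    rewrite mem_filter => /andP[Pz zs].
    have [z1 /andP[g1 g2] /andP[g3 g4] /andP[g5 g6] _] := geo zk zs Pz.
    have dF := cdist_ge_1B F0 FT zk.1.
    have le1 : 1 - cmod zk.1 <= cmod (zk.1 - e).
      by have := ler_cmod_dist e zk.1; rewrite eT cmodB => /(le_trans (ler_norm _)).
    by clear -g1 g4 g6 dF le1; split; lra.
  (* dist(z, E) is replaced by |z - e|, which is no smaller, so that one point e serves for the
     whole class. *)
  have fK' z : cmod z < 1 -> ln (cmod (f z)) <=
      K / (1 - cmod z) `^ p * (cmod (z - e) `^ r / cdist z F `^ q).
    move=> z1; apply: le_trans (fK z z1) _.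
    rewrite ler_wpM2l ?divr_ge0 ?powR_ge0 ?(ltW K0) // ler_wpM2r ?invr_ge0 ?powR_ge0 //.
    have [nE nd] := Hnear z.
    apply: ge0_ler_powR; rewrite ?nnegrE ?cmod_ge0 ?nd ?cmod_ge0 // -nd.
    by apply: cdist_lb => /=; exact: mem_nth.
  have HZ := HC e eT f K Z D S B K0 fa f1 fK' D0 S0 B0.
  have {}HZ : (size [seq zk <- s | P zk])%:R * D <=
      C * K * (D `^ (- p) * S `^ beta * B `^ (- (w + eps / 6))).
    rewrite -(size_map fst); apply: HZ.
    - move=> z /mapP[zk]; rewrite mem_filter => /andP[Pz zs] ->.
      by have [z1 g2 g3 g4 _] := geo zk zs Pz.
    - by move=> z zZ; exact: (count_zeros_mult us hs zZ).
  pose Wt := (2 * D) `^ (p + 1 + eps) * ((2 * B) `^ w / S `^ r').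
  have GW zk : zk \in s -> P zk -> G zk <= Wt.
    move=> zs Pz; have [z1 /andP[g1 g2] /andP[g3 g4] /andP[g5 g6] gE] := geo zk zs Pz.
    have k0 := cmod_ge0 zk.1.
    rewrite /G /Wt gE; apply: ler_pM; rewrite ?powR_ge0 ?divr_ge0 ?powR_ge0 //.
      by clear -g1 g2 D0 p0 eps0; apply: ge0_ler_powR; rewrite ?nnegrE; lra.
    apply: ler_pM; rewrite ?powR_ge0 ?invr_ge0 ?powR_ge0 //.
      by clear -g5 g6 B0 w0; apply: ge0_ler_powR; rewrite ?nnegrE //; lra.
    rewrite lef_pV2 ?posrE ?powR_gt0 //; last by apply: lt_le_trans g3.
    by clear -g3 g4 S0 r'0; apply: ge0_ler_powR; rewrite ?nnegrE //; lra.
  have Wt0 : 0 <= Wt by rewrite mulr_ge0 ?divr_ge0 ?powR_ge0.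
  apply: (@le_trans _ _ ((size [seq zk <- s | P zk])%:R * Wt)).
    rewrite -sum1_size natr_sum big_distrl /= big_filter big_seq_cond [leRHS]big_seq_cond.
    by apply: ler_sum => zk /andP[zs Pz]; rewrite mul1r; exact: GW.
  set X := D `^ (- p) * S `^ beta * B `^ (- (w + eps / 6)) in HZ.
  have HZ' : (size [seq zk <- s | P zk])%:R <= C * K * X / D by rewrite ler_pdivlMr.
  apply: (le_trans (ler_wpM2r Wt0 HZ')).
  have := class_weight_le p w D0 D1 S0 S1 B0 B1 DS DB eps0 br'.
  rewrite -/X -/Wt.
  have CK : 0 <= C * K by rewrite mulr_ge0 ?ltW.
  move=> /(ler_wpM2l CK) hX.
  have -> : C * K * X / D * Wt = C * K * (X / D * Wt) by ring.
  apply: (le_trans hX).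
  have om n : ((2^-1 : R) ^+ n) `^ (eps / 6) = omega ^+ n.
    by rewrite powR_exprn // invr_ge0.
  rewrite DE SE BE !om /Q le_eqVlt; apply/orP; left; apply/eqP; ring.
rewrite (@sum_partition_nat _ _ s xpredT G h1 (size E)); last first.
  by move=> zk _ _; rewrite index_mem; case: (Hnear zk.1).
have -> : (size E)%:R * (Q / (1 - omega) / (1 - omega) / (1 - omega)) * K =
   \sum_(a < size E) Q * K / (1 - omega) / (1 - omega) / (1 - omega).
  by rewrite sumr_const card_ord -[RHS]mulr_natl; ring.
apply: ler_sum => a _ /=.
have QK : 0 <= Q * K by rewrite mulr_ge0 // ltW.
have W : 0 <= (1 - omega)^-1 by rewrite invr_ge0 ltW.
apply: (sum_geometric_classes (h := h2) _ om0 om1) => [|b].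
  by rewrite mulr_ge0 // mulr_ge0.
have -> : Q * K / (1 - omega) / (1 - omega) * omega ^+ b =
  Q * K * omega ^+ b / (1 - omega) / (1 - omega) by ring.
apply: (sum_geometric_classes (h := h3) _ om0 om1) => [|c].
  by rewrite mulr_ge0 // mulr_ge0 // exprn_ge0.
have -> : Q * K * omega ^+ b / (1 - omega) * omega ^+ c =
  Q * K * omega ^+ b * omega ^+ c / (1 - omega) by ring.
apply: (sum_geometric_classes (h := h4) _ om0 om1) => [|d].
  by rewrite mulr_ge0 ?exprn_ge0 // mulr_ge0 // exprn_ge0.
exact: main.
Qed.

Theorem theorem0p3 (R : realType) (E : seq R[i]) (F : set R[i]) (p q r : R) :
  E != [::] -> (forall zeta, zeta \in E -> on_circle zeta) ->
  F !=set0 -> F `<=` @on_circle R -> cclosed F ->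
  (forall zeta, zeta \in E -> ~ F zeta) ->
  0 <= p -> 0 <= q -> 0 <= r ->
  forall eps : R, 0 < eps ->
  exists C4 : R, 0 < C4 /\
    forall (f : R[i] -> R[i]) (K : R), 0 < K ->
      analytic_on_disk f -> cmod (f 0) = 1 ->
      (forall z, cmod z < 1 ->
         ln (cmod (f z)) <=
           K / (1 - cmod z) `^ p * (cdist z [set w | w \in E] `^ r / cdist z F `^ q)) ->
      (\esum_(zk in zeros_mult f)
         ((1 - cmod zk.1) `^ (p + 1 + eps)
          * (cdist zk.1 F `^ Num.max (q - AC_type F + eps) 0
             / cdist zk.1 [set w | w \in E] `^ Num.min p r))%:E
       <= (C4 * K)%:E)%E.
Proof.
move=> E0 ET F0 FT _ _ p0 q0 r0 eps eps0.
have [C [C0 H]] := zero_sum_le E0 ET F0 FT p0 q0 r0 eps0.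
exists C; split=> // f K K0 fa f1 fK.
apply: ub_ereal_sup => _ [A [finA sA] <-].
rewrite fsbig_finite //= sumEFin lee_fin; apply: (H f K) => //; first exact: finmap.fset_uniq.
by move=> zk; rewrite in_fset_set // inE => /sA.
Qed.
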